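(* Let $G$ be an amenable discrete infinite countable group. Let $(X,d)$ be a Polish ultrametric space, $\mathcal R$ a countable Borel equivalence relation on $X$, $\mu$ a probability Borel measure on $X$, and $Q=(Q_g)_{g\in G}$ a conservative nonsingular $G$-action on $(X,\mu)$. Suppose that there is a $\mu$-conull subset $X_0\subset X$ such that - $(Q_g\times Q_g)(\mathcal R\cap(X_0\times X_0))=\mathcal R\cap(X_0\times X_0)$ for all $g\in G$; - if $(Q_gx,x)\in\mathcal R$ for some $x\in X_0$ and $g\in G$, then $g=1$; - the restriction of $Q$ to the $\sigma$-algebra $\mathrm{Inv}(\mathcal R)$ of $\mathcal R$-saturated subsets is ergodic; - $\lim_{g\to\infty}d(Q_gx,Q_gy)=0$ for all $(x,y)\in\mathcal R\cap(X_0\times X_0)$; - there is a Borel map $\alpha:\mathcal R\to[1,+\infty)$ with $$\alpha(x,y)^{-1}<\frac{d\mu\circ Q_g}{d\mu}(x)\Big/\frac{d\mu\circ Q_g}{d\mu}(y)<\alpha(x,y)$$ for all $(x,y)\in\mathcal R\cap(X_0\times X_0)$ and each $g\in G$. Then $Q$ is ergodic. If, moreover, $\mathrm{Inv}(\mathcal R)$ is trivial $\pmod\mu$, then $Q$ is weakly mixing.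
   Context: A Polish ultrametric space is a Polish space with an ultrametric $d$ compatible with its topology. A Borel equivalence relation $\mathcal R\subset X\times X$ is countable if each class $\mathcal R(x)=\{y:(x,y)\in\mathcal R\}$ is countable. A Borel set $B\subset X$ is $\mathcal R$-saturated if $B=\bigcup_{x\in B}\mathcal R(x)$; $\mathrm{Inv}(\mathcal R)$ is the $\sigma$-algebra of all $\mathcal R$-saturated Borel sets. It is trivial mod $\mu$ if each of its elements is $\mu$-null or $\mu$-conull. The restriction of $Q$ to $\mathrm{Inv}(\mathcal R)$ is ergodic if every $B\in\mathrm{Inv}(\mathcal R)$ that is $Q$-invariant (mod $\mu$) is $\mu$-null or $\mu$-conull. The relation $\mathcal R$ itself is not assumed to be $\mu$-nonsingular. The Radon–Nikodym derivatives $\frac{d\mu\circ Q_g}{d\mu}$ are fixed Borel versions. The limit as $g\to\infty$ means: for every $\varepsilon>0$ there is a finite $F\subset G$ such that $d(Q_gx,Q_gy)<\varepsilon$ for all $g\notin F$. A nonsingular action of $G$ on a $\sigma$-finite standard measure space $(Y,\nu)$ is a Borel action $Q=(Q_g)_{g\in G}$ with $\nu\circ Q_g\sim\nu$ (same null sets) for every $g$. $Q$ is conservative if for every measurable $B$ with $\nu(B)>0$ and for a.e. $y\in B$, the set $\{g\in G: Q_gy\in B\}$ is infinite. $Q$ is ergodic if every $Q$-invariant measurable set is null or conull. $Q$ is weakly mixing if for each ergodic measure preserving $G$-action $R=(R_g)_{g\in G}$ on a standard probability space, the product $G$-action $(Q_g\times R_g)_{g\in G}$ is ergodic (with respect to the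 product measure). *)

(* Defs.v *)
From HB Require Import structures.
From mathcomp Require Import all_boot all_order all_algebra.
From mathcomp Require Import all_classical all_reals all_analysis.

Set Implicit Arguments.
Unset Strict Implicit.
Unset Printing Implicit Defensive.

Import Order.TTheory GRing.Theory Num.Theory.
Import numFieldNormedType.Exports.

Local Open Scope classical_set_scope.
Local Open Scope ring_scope.

(* The points of T with the Borel sigma-algebra of the topology of T. *)
Notation borel T := (g_sigma_algebraType (@open T)).

Section PolishSpaces.
Variable R : realType.

Definition is_metric (T : Type) (dist : T -> T -> R) : Prop :=
  [/\ forall x y, 0 <= dist x y,
      forall x y, dist x y = 0 <-> x = y,
      forall x y, dist x y = dist y x &
      forall x y z, dist x z <= dist x y + dist y z].

Definition is_ultrametric (T : Type) (dist : T -> T -> R) : Prop :=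
  is_metric dist /\
  forall x y z, dist x z <= Num.max (dist x y) (dist y z).

Definition compatible_metric (T : topologicalType) (dist : T -> T -> R) : Prop :=
  forall x : T,
    nbhs x = filter_from [set e : R | 0 < e] (fun e => [set y | dist x y < e]).

Definition complete_metric (T : topologicalType) (dist : T -> T -> R) : Prop :=
  forall u : nat -> T,
    (forall e : R, 0 < e ->
       exists N, forall m n, (N <= m)%N -> (N <= n)%N -> dist (u m) (u n) < e) ->
    exists l : T, u @ \oo --> l.

Definition polish (T : topologicalType) : Prop :=
  (exists2 D : set T, countable D & dense D) /\
  exists dist : T -> T -> R,
    [/\ is_metric dist, compatible_metric dist & complete_metric dist].

(* The compatible ultrametric need not be complete. *)
Definition polish_ultrametric (T : topologicalType) (dist : T -> T -> R) : Prop :=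
  [/\ polish T, is_ultrametric dist & compatible_metric dist].

Definition standard_borel d (Z : measurableType d) : Prop :=
  exists (T : ptopologicalType) (f : Z -> T) (h : T -> Z),
    [/\ polish T, cancel f h, cancel h f,
        measurable_fun [set: Z] (f : Z -> borel T) &
        measurable_fun [set: borel T] (h : borel T -> Z)].

End PolishSpaces.

(* von Neumann's definition for discrete groups: a finitely additive
   left-invariant probability defined on all subsets of G. *)
Definition amenable (R : realType) (G : groupType) : Prop :=
  exists m : set G -> R,
    [/\ forall A, 0 <= m A,
        m [set: G] = 1,
        forall A B, A `&` B = set0 -> m (A `|` B) = m A + m B &
        forall g A, m [set (g * a)%g | a in A] = m A].

Section Actions.
Context (R : realType) (G : groupType) d (Y : measurableType d).
Implicit Types (nu : {measure set Y -> \bar R}) (Q : G -> Y -> Y).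

Definition borel_action Q : Prop :=
  [/\ forall y, Q 1%g y = y,
      forall g h y, Q (g * h)%g y = Q g (Q h y) &
      forall g, measurable_fun [set: Y] (Q g)].

(* The measure written nu \o Q_g is A |-> nu (Q_g A), with images, not preimages. *)
Definition nonsingular nu Q : Prop :=
  borel_action Q /\
  forall g A, measurable A -> (nu (Q g @` A) = 0%E <-> nu A = 0%E).

Definition measure_preserving nu Q : Prop :=
  borel_action Q /\
  forall g A, measurable A -> nu (Q g @` A) = nu A.

Definition conservative nu Q : Prop :=
  forall B, measurable B -> (0 < nu B)%E ->
    {ae nu, forall y, B y -> infinite_set [set g | B (Q g y)]}.

Definition null_or_conull nu (B : set Y) : Prop :=
  nu B = 0%E \/ nu (~` B) = 0%E.

Definition ergodic nu Q : Prop :=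
  forall B, measurable B -> (forall g, Q g @` B = B) -> null_or_conull nu B.

(* f is a Borel version of the derivative of A |-> nu (T A) with respect to nu. *)
Definition is_rn_derivative nu (T : Y -> Y) (f : Y -> R) : Prop :=
  [/\ measurable_fun [set: Y] f,
      forall y, 0 <= f y &
      forall A, measurable A -> nu (T @` A) = (\int[nu]_(y in A) (f y)%:E)%E].

End Actions.

Definition product_action (G Y Z : Type) (Q : G -> Y -> Y) (S : G -> Z -> Z) :
    G -> Y * Z -> Y * Z :=
  fun g p => (Q g p.1, S g p.2).

Definition weakly_mixing (R : realType) (G : groupType) d (Y : measurableType d)
    (nu : {measure set Y -> \bar R}) (Q : G -> Y -> Y) : Prop :=
  forall (d' : measure_display) (Z : measurableType d') (rho : probability Z R)
    (S : G -> Z -> Z),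
    standard_borel R Z -> measure_preserving rho S -> ergodic rho S ->
    ergodic (nu \x rho)%E (product_action Q S).

Section EquivalenceRelations.
Context d (Y : measurableType d).
Implicit Types E : set (Y * Y).

Definition eq_class E (x : Y) : set Y := [set y | E (x, y)].

Definition countable_borel_equivalence E : Prop :=
  [/\ measurable E,
      forall x, E (x, x),
      forall x y, E (x, y) -> E (y, x),
      forall x y z, E (x, y) -> E (y, z) -> E (x, z) &
      forall x, countable (eq_class E x)].

Definition saturated_sets E : set (set Y) :=
  [set B | measurable B /\ B = \bigcup_(x in B) eq_class E x].

Definition inv_trivial (R : realType) (mu : {measure set Y -> \bar R}) E : Prop :=
  forall B, saturated_sets E B -> null_or_conull mu B.

(* B is exactly E-saturated, but Q-invariant only mod mu. *)
Definition inv_ergodic (R : realType) (G : groupType)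
    (mu : {measure set Y -> \bar R}) (Q : G -> Y -> Y) E : Prop :=
  forall B, saturated_sets E B ->
    (forall g, mu ((Q g @` B `\` B) `|` (B `\` Q g @` B)) = 0%E) ->
    null_or_conull mu B.

End EquivalenceRelations.

(* Main.v *)
Require Import Defs.
From mathcomp Require Import all_boot all_order all_algebra.
From mathcomp Require Import finmap ring lra.
From mathcomp Require Import all_classical all_reals all_analysis.
From mathcomp Require Import measurable_realfun.

Set Implicit Arguments.
Unset Strict Implicit.
Unset Printing Implicit Defensive.

Import Order.TTheory GRing.Theory Num.Theory.
Import numFieldNormedType.Exports.

Local Open Scope classical_set_scope.
Local Open Scope ring_scope.

(** Let [B] be an invariant set, of [Q] itself or of [product_action Q S]. The point
    is that, up to a null set, membership in [B] does not change when the first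
    coordinate moves within a class of [Rel]. The averages that show this are the
    following. Write [w g] for the derivative of [A |-> mu (Q g @` A)]. For a finite
    set [F] in [G] and a position [c] in [F], form the ratio average of a function
    along the piece [F * c^-1] of the orbit of a point, with weights [w], and let
    [folner_average] be the mean over all [c] in [F]. It is a conditional
    expectation on [Y * F] followed by integration over [F]; so it preserves
    integrals and positivity, it fixes invariant functions, and therefore it moves
    no function away from [\1_B] in L1 (lemma [folner_average_dist]).

    The pieces of orbit used do not depend on the point. Hence for two points of
    [Rel], with weights comparable up to a factor [a] and with orbits that a
    uniformly clopen set [A] cannot tell apart off a finite set [K], the averages
    of [A] are comparable up to [a ^+ 2] and an error, the share of the weight that
    is carried by [K] (lemma [folner_average_compare]). Conservativity makes the sum
    of all weights infinite (lemma [conservative_recurrent]), and along a Folner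
    sequence most positions see any given finite part of the orbit, so the error
    tends to zero (lemma [weight_share_cvg0]). Uniformly clopen sets approximate all
    measurable sets, thanks to the ultrametric inequality; approximating [B] by
    them one would conclude if the averages of each [A] converged almost
    everywhere. Suitable convex combinations of tails do (lemma
    [tail_hull_cauchy]), and they satisfy the same estimates. This is
    [invariant_set_contracting_pair].

    It remains to pass from a set that is [Rel]-invariant off a null set to a Borel
    set that is saturated. As [Rel] does not preserve null sets, this uses the
    separation of disjoint saturated analytic sets ([saturated_separation]). Then
    ergodicity on the saturated sets gives the first claim. For weak mixing, each
    fiber of an invariant set is null or conull, and ergodicity of [S] decides
    which. The existence of Folner sets is derived from an invariant mean: without
    them, Hall's theorem would produce a paradoxical decomposition of [G]. *)

(** * Hall's theorem for infinite families of finite sets *)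

Section Hall.
Variables A B : choiceType.
Implicit Types (N : A -> {fset B}) (F : {fset A}).

Definition neighbours N F : {fset B} := (\bigcup_(a <- F) N a)%fset.

Definition hall_condition N := forall F, (#|` F| <= #|` neighbours N F|)%N.

Lemma neighboursP N F b :
  reflect (exists2 a, a \in F & b \in N a) (b \in neighbours N F).
Proof.
apply: (iffP (bigfcupP _ _ _ _)) => [[a /andP[aF _] ba]|[a aF ba]].
  by exists a.
by exists a; rewrite ?aF.
Qed.

Lemma eq_neighbours N N' F : (forall a, a \in F -> N a = N' a) ->
  neighbours N F = neighbours N' F.
Proof.
move=> NN'; apply/fsetP => b; apply/neighboursP/neighboursP => -[a aF ba];
  by exists a; rewrite // -?NN'// NN'.
Qed.

Lemma neighboursU N F1 F2 :
  neighbours N (F1 `|` F2)%fset = (neighbours N F1 `|` neighbours N F2)%fset.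
Proof.
apply/fsetP => b; rewrite inE; apply/neighboursP/orP.
  by case=> a; rewrite inE => /orP[] aF ba; [left|right];
    apply/neighboursP; exists a.
by case=> /neighboursP[a aF ba]; exists a; rewrite // inE aF ?orbT.
Qed.

Lemma neighboursI N F1 F2 :
  (neighbours N (F1 `&` F2) `<=` neighbours N F1 `&` neighbours N F2)%fset.
Proof.
apply/fsubsetP => b /neighboursP[a]; rewrite !inE => /andP[a1 a2] ba.
by apply/andP; split; apply/neighboursP; exists a.
Qed.

(** Along a chain the finite sets [N a] stabilise, and Hall's condition looks at
    finitely many of them at a time, so it passes to the intersection of the
    chain and Zorn's lemma applies. *)
Lemma exists_minimal_hall N : hall_condition N ->
  exists M, [/\ hall_condition M, forall a, (M a `<=` N a)%fset &
    forall M', hall_condition M' -> (forall a, M' a `<=` M a)%fset -> M' = M].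
Proof.
move=> hN.
pose T := {M : A -> {fset B} | hall_condition M /\ forall a, (M a `<=` N a)%fset}.
pose r (M M' : T) := `[< forall a, (sval M' a `<=` sval M a)%fset >].
have : exists M : T, forall M', r M M' -> M' = M.
  apply: (@Zorn T r).
  - by move=> M; apply/asboolP => a; exact: fsubset_refl.
  - move=> M1 M2 M3 /asboolP h12 /asboolP h23; apply/asboolP => a.
    exact: fsubset_trans (h23 a) (h12 a).
  - move=> [M1 h1] [M2 h2] /asboolP/= h12 /asboolP/= h21.
    apply: eq_exist; apply/funext => a; apply/eqP.
    by rewrite eqEfsubset h12 h21.
  move=> C Ctot; have [->|/set0P[M0 CM0]] := eqVneq C set0.
    have hNN : hall_condition N /\ forall a, (N a `<=` N a)%fset.
      by split=> // a; exact: fsubset_refl.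
    by exists (exist _ N hNN).
  (* the intersection of the chain *)
  pose L a : {fset B} :=
    [fset b in N a | `[< forall M, C M -> b \in sval M a >]]%fset.
  have LC M a : C M -> (L a `<=` sval M a)%fset.
    by move=> CM; apply/fsubsetP => b; rewrite !inE => /andP[_ /asboolP]; exact.
  have stable1 a : exists2 M, C M & sval M a = L a.
    have ex : exists n, `[< exists2 M, C M & #|` sval M a| = n >].
      by exists #|` sval M0 a|; apply/asboolP; exists M0.
    have [n /asboolP[M CM Mn] nmin] := ex_minnP ex.
    exists M => //; apply/eqP; rewrite eqEfsubset LC// andbT.
    apply/fsubsetP => b bM; rewrite !inE/=; apply/andP; split.
      by have [_ /(_ a)/fsubsetP] := svalP M; apply.
    apply/asboolP => M' CM'; have [/asboolP/(_ a)|/asboolP/(_ a)] := Ctot _ _ CM CM'.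
      move=> M'M; suff -> : sval M' a = sval M a by [].
      apply/eqP; rewrite eqEfcard M'M/= Mn; apply: nmin.
      by apply/asboolP; exists M'.
    by move/fsubsetP; apply.
  have stable (s : seq A) : exists2 M, C M & forall a, a \in s -> sval M a = L a.
    elim: s => [|a s [M CM Ms]]; first by exists M0.
    have [M1 CM1 M1a] := stable1 a.
    have [/asboolP MM|/asboolP MM] := Ctot _ _ CM CM1.
      exists M1 => // c; rewrite inE => /predU1P[->//|/Ms Mc].
      by apply/eqP; rewrite eqEfsubset LC// andbT -Mc.
    exists M => // c; rewrite inE => /predU1P[->|/Ms//].
    by apply/eqP; rewrite eqEfsubset LC// andbT -M1a.
  have hL : hall_condition L /\ forall a, (L a `<=` N a)%fset.
    split=> [F|a]; last by apply/fsubsetP => b; rewrite !inE => /andP[].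
    have [M CM MF] := stable F; have [hM _] := svalP M.
    by rewrite -(eq_neighbours MF); exact: hM.
  by exists (exist _ L hL) => M CM; apply/asboolP => a; exact: LC.
case=> -[M [hM MN]] Mmin; exists M; split => // M' hM' M'M.
have hM'' : hall_condition M' /\ forall a, (M' a `<=` N a)%fset.
  by split=> // a; exact: fsubset_trans (M'M a) (MN a).
have : r (exist _ M (conj hM MN)) (exist _ M' hM'') by exact/asboolP.
by move/Mmin => /(congr1 (@sval _ _)).
Qed.

(** Rado's argument for Hall's theorem. In a minimal family every set is a
    singleton: were [b1] and [b2] both in [M a], removing either one would break
    Hall's condition at some [a |` F1], resp. [a |` F2], and submodularity of
    [F |-> #|neighbours F|] would contradict the condition at the union and at
    the intersection of [F1] and [F2]. *)
Theorem hall_infinite N : hall_condition N ->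
  exists2 theta : A -> B, injective theta & forall a, theta a \in N a.
Proof.
move=> /exists_minimal_hall[M [hM MN Mmin]].
pose del a b c := if c == a then (M a `\ b)%fset else M c.
have del_viol a b : b \in M a -> exists2 F : {fset A}, a \notin F &
    (#|` neighbours M F `|` (M a `\ b)|%fset <= #|` F|)%N.
  move=> bMa; have : ~ hall_condition (del a b).
    move=> /Mmin h; have /h/(congr1 (fun f => f a)) : forall c, (del a b c `<=` M c)%fset.
      by move=> c; rewrite /del; case: eqP => [->|_]; rewrite ?fsubD1set ?fsubset_refl.
    by rewrite /del eqxx => /fsetP/(_ b); rewrite !inE eqxx bMa.
  move=> /existsNP[F /negP]; rewrite -ltnNge => hF.
  have delE (F' : {fset A}) : a \notin F' -> neighbours (del a b) F' = neighbours M F'.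
    move=> aF; apply: eq_neighbours => c cF; rewrite /del; case: eqP => // ca.
    by move: aF; rewrite -ca cF.
  have [aF|aF] := boolP (a \in F); last first.
    by move: hF; rewrite delE// ltnNge hM.
  exists (F `\ a)%fset; first by rewrite !inE eqxx.
  move: hF; rewrite (cardfsD1 a F) aF add1n ltnS -{1}(fsetD1K aF) neighboursU.
  rewrite (delE (F `\ a)%fset) ?inE ?eqxx// fsetUC.
  have -> // : neighbours (del a b) [fset a]%fset = (M a `\ b)%fset.
  apply/fsetP => c; apply/neighboursP/idP => [[x]|cMa].
    by rewrite inE => /eqP ->; rewrite /del eqxx.
  by exists a; rewrite ?inE// /del eqxx.
have M_nonempty a : exists b, b \in M a.
  have := hM [fset a]%fset; rewrite cardfs1 cardfs_gt0 => /fset0Pn[b].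
  by case/neighboursP => c; rewrite inE => /eqP -> bMa; exists b.
have M_single a b1 b2 : b1 \in M a -> b2 \in M a -> b1 = b2.
  move=> b1a b2a; apply/eqP/negPn/negP => b12.
  have [F1 aF1 h1] := del_viol _ _ b1a; have [F2 aF2 h2] := del_viol _ _ b2a.
  set D1 := (neighbours M F1 `|` _)%fset in h1.
  set D2 := (neighbours M F2 `|` _)%fset in h2.
  have hU : (#|` F1 `|` F2|%fset < #|` D1 `|` D2|%fset)%N.
    apply: (@leq_trans #|` neighbours M (a |` (F1 `|` F2))%fset|).
      have := hM (a |` (F1 `|` F2))%fset.
      by rewrite cardfsU1 inE negb_or aF1 aF2.
    apply/fsubset_leq_card/fsubsetP => b /neighboursP[c]; rewrite !inE.
    case/or3P => [/eqP->|cF|cF] bc.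
    - rewrite bc !andbT; have [->|] := eqVneq b b1; first by rewrite b12 !orbT.
      by rewrite !orbT.
    - by rewrite (_ : b \in neighbours M F1)//; apply/neighboursP; exists c.
    - by rewrite (_ : b \in neighbours M F2) ?orbT//; apply/neighboursP; exists c.
  have hI : (#|` F1 `&` F2|%fset <= #|` D1 `&` D2|%fset)%N.
    apply: leq_trans (hM _) _; apply/fsubset_leq_card.
    apply: fsubset_trans (neighboursI _ _ _) _.
    by apply: fsetISS; exact: fsubsetUl.
  have := leq_add hU hI; rewrite addSn !cardfsUI => h.
  by move: (leq_trans h (leq_add h1 h2)); rewrite ltnn.
have [theta thetaP] := choice M_nonempty.
exists theta => [a1 a2 th12|a]; last by have /fsubsetP := MN a; apply.
apply/eqP/negPn/negP => a12.
have := hM [fset a1; a2]%fset; rewrite cardfs2 a12.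
suff -> : neighbours M [fset a1; a2]%fset = [fset theta a1]%fset by rewrite cardfs1.
apply/fsetP => b; rewrite !inE; apply/neighboursP/eqP => [[c]|->].
  rewrite !inE => /orP[] /eqP -> bM; last rewrite th12; exact: M_single bM _.
by exists a1; rewrite ?inE ?eqxx.
Qed.

End Hall.

(** * Folner sequences from invariant means *)

Section Folner.
Variable G : groupType.
Implicit Types (S K L F : {fset G}).

Definition mul_fset S F : {fset G} := [fset (s * x)%g | s in S, x in F]%fset.

Lemma mul_fsetA S K F : mul_fset (mul_fset S K) F = mul_fset S (mul_fset K F).
Proof.
apply/fsetP => y; apply/imfset2P/imfset2P => /=.
  case=> _ /imfset2P[s sS [k kK ->]] [x xF ->].
  by exists s => //; exists (k * x)%g; rewrite ?mulgA//; apply: in_imfset2.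
case=> s sS [_ /imfset2P[k kK [x xF ->]] ->].
by exists (s * k)%g; [exact: in_imfset2|exists x; rewrite ?mulgA].
Qed.

(** An invariant mean does not see a permutation of finitely many translated
    pieces. *)
Lemma mean_piecewise_translation (R : realType) (m : set G -> R)
    (mD : forall A B, A `&` B = set0 -> m (A `|` B) = m A + m B)
    (mT : forall g A, m [set (g * a)%g | a in A] = m A)
    (tau : G -> G) (K : {fset G}) :
  injective tau -> (forall x, (tau x * x^-1)%g \in K) -> m (range tau) = m [set: G].
Proof.
move=> tau_inj tauK.
have m0 : m set0 = 0.
  by apply/eqP; rewrite -(addrK (m set0) (m set0)) -mD ?setI0// setU0 subrr.
pose P (s : seq G) := [set x | (tau x * x^-1)%g \in s].
have img (s : seq G) : uniq s -> m (tau @` P s) = m (P s).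
  elim: s => [_|k s IHs /andP[ks /IHs us]].
    by rewrite (_ : P [::] = set0) ?image_set0// -subset0 => x; rewrite /P/= in_nil.
  pose Ak := [set x | tau x = (k * x)%g].
  have Pks : P (k :: s) = Ak `|` P s.
    apply/seteqP; split=> x; rewrite /P /Ak/= inE.
      by case/predU1P => [<-|->]; [left; rewrite mulgVK|right].
    by case=> [->|->]; rewrite ?orbT// mulgK eqxx.
  have disj : Ak `&` P s = set0.
    rewrite -subset0 => x [/= xk]; rewrite /P/= xk mulgK => ks'.
    by rewrite ks' in ks.
  have -> : tau @` P (k :: s) = [set (k * a)%g | a in Ak] `|` tau @` P s.
    rewrite Pks image_setU; congr (_ `|` _); apply/seteqP.
    by split=> _ [x xk <-]; exists x => //; rewrite xk.
  rewrite Pks !mD ?mT ?us// -subset0 => _ [[x /= xk <-] [y ys]].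
  rewrite -xk => /tau_inj yx; rewrite yx in ys.
  by have : (Ak `&` P s) x by []; rewrite disj.
have -> : range tau = tau @` P K.
  by congr image; apply/seteqP; split=> // x _; exact: tauK.
by rewrite img ?fset_uniq//; congr m; apply/seteqP; split=> // x _; exact: tauK.
Qed.

(** If every finite set were expanded by [S] at a fixed rate, a power of [S]
    would double every finite set; Hall's theorem turns the doubling into two
    injections of [G] with disjoint images, each a piecewise translation with
    finitely many pieces, and an invariant mean cannot accommodate both. *)
Lemma amenable_small_expansion (R : realType) S (e : R) :
  amenable R G -> 0 < e -> exists2 F : {fset G}, F != fset0 &
    #|` mul_fset S F|%:R <= (1 + e) * #|` F|%:R.
Proof.
move=> [m [m0 m1 mD mT]] e0; apply: contrapT => noF.
have expand F : (1 + e) * #|` F|%:R <= #|` mul_fset S F|%:R.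
  have [->|F0] := eqVneq F fset0; first by rewrite cardfs0 mulr0.
  by apply/ltW; rewrite ltNge; apply/negP => h; apply: noF; exists F.
pose K n := iter n (mul_fset S) [fset 1%g]%fset.
have one_mul F : mul_fset [fset 1%g]%fset F = F.
  apply/fsetP => y; apply/imfset2P/idP => /=.
    by case=> s; rewrite inE => /eqP -> [x xF ->]; rewrite mul1g.
  by move=> yF; exists 1%g; rewrite ?inE//; exists y; rewrite ?mul1g.
have expandn n F : (1 + e) ^+ n * #|` F|%:R <= #|` mul_fset (K n) F|%:R.
  elim: n => [|n IHn]; first by rewrite expr0 mul1r one_mul.
  rewrite exprS -mulrA mul_fsetA; apply: le_trans (expand _).
  by apply: ler_wpM2l => //; rewrite addr_ge0// ltW.
have [n n2] : exists n, 2 <= (1 + e) ^+ n.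
  have [n ne] := ltr_add_invr (R := R) (e0 : 0 < e); exists n.+1.
  have : 1 + n.+1%:R * e <= (1 + e) ^+ n.+1.
    elim: (n.+1) => [|k IHk]; first by rewrite mul0r addr0 expr0.
    rewrite exprS; apply: le_trans (_ : (1 + e) * (1 + k%:R * e) <= _); last first.
      by apply: ler_wpM2l => //; rewrite addr_ge0// ltW.
    rewrite -natr1 (_ : (1 + e) * _ = 1 + (k%:R + 1) * e + k%:R * e ^+ 2); last by ring.
    by rewrite lerDl mulr_ge0// exprn_ge0// ltW.
  apply: le_trans; rewrite -[2]/(1 + 1) lerD2l -ler_pdivrMl// mulr1 ltW//.
  by rewrite -[ltLHS]add0r.
pose N (a : G * bool) : {fset G} := mul_fset (K n) [fset a.1]%fset.
have hallN : hall_condition N.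
  move=> F; pose F1 := [fset a.1 | a in F]%fset.
  have -> : neighbours N F = mul_fset (K n) F1.
    apply/fsetP => y; apply/neighboursP/imfset2P => /=.
      case=> a aF /imfset2P[/= k kK [x]]; rewrite inE => /eqP -> ->.
      by exists k => //; exists a.1 => //; exact: in_imfset.
    case=> k kK [_ /imfsetP[/= a aF ->] ->]; exists a => //.
    by apply: in_imfset2; rewrite ?inE.
  rewrite -(ler_nat R); apply: le_trans (expandn n F1).
  have : (#|` F| <= 2 * #|` F1|)%N.
    pose C b := ((fun x : G => (x, b) : (G * bool)%type) @` F1)%fset.
    have FF1 : (F `<=` C true `|` C false)%fset.
      apply/fsubsetP => a aF; rewrite inE.
      have Ca : a \in C a.2.
        by apply/imfsetP; exists a.1; [exact: in_imfset|case: (a)].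
      by move: Ca; case: (a.2) => ->; rewrite ?orbT.
    apply: leq_trans (fsubset_leq_card FF1) _; rewrite mul2n -addnn cardfsU.
    by apply: leq_trans (leq_subr _ _) _; rewrite leq_add// leq_imfset_card.
  rewrite -(ler_nat R) natrM => /le_trans; apply.
  by rewrite ler_wpM2r.
have [theta theta_inj thetaN] := hall_infinite hallN.
have thetaK b x : (theta (x, b) * x^-1)%g \in K n.
  have /imfset2P[/= k kK [y]] := thetaN (x, b).
  by rewrite inE => /eqP -> ->; rewrite mulgK.
have full b : m (range (fun x => theta (x, b))) = 1.
  by rewrite (mean_piecewise_translation mD mT _ (thetaK b))// => x y /theta_inj[].
have : m (range (fun x => theta (x, true)) `|` range (fun x => theta (x, false))) <= 1.
  set U := (U in m U <= _).
  by rewrite -m1 -(setUv U) [in leRHS]mD ?setICr// lerDl.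
rewrite mD; last first.
  by rewrite -subset0 => _ [[x _ <-] [y _ /theta_inj]].
by rewrite !full -[leRHS]addr0 lerD2l lt_geF.
Qed.

Definition inner_boundary L F : {fset G} :=
  [fset c in F | ~~ all (fun l => (l * c)%g \in F) L]%fset.

(** A point of the boundary is [l^-1 * x] for some [l] in [L] and some [x] that
    [L] adds to [F]; so the rate of expansion is taken below [e / #|L|]. *)
Lemma amenable_folner (R : realType) L (e : R) :
  amenable R G -> 0 < e -> exists2 F : {fset G}, F != fset0 &
    #|` inner_boundary L F|%:R <= e * #|` F|%:R.
Proof.
move=> am e0; pose q : R := e / #|` L|.+1%:R.
have q0 : 0 < q by rewrite divr_gt0.
have [F F0 hF] := amenable_small_expansion (1%g |` L)%fset am q0.
exists F => //; set S := (1%g |` L)%fset in hF; set D := (mul_fset S F `\` F)%fset.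
have FSF : (F `<=` mul_fset S F)%fset.
  apply/fsubsetP => x xF; rewrite -[x]mul1g; apply: in_imfset2 => //.
  by rewrite !inE eqxx.
have cD : #|` D|%:R <= q * #|` F|%:R.
  move: hF; rewrite -(cardfsID F (mul_fset S F)) (fsetIidPr FSF) natrD mulrDl mul1r.
  by rewrite lerD2l.
have cB (s : seq G) : {subset s <= L} ->
    (#|` [fset c in F | ~~ all (fun l => (l * c)%g \in F) s]%fset|
      <= size s * #|` D|)%N.
  elim: s => [|l s IHs] sL.
    by rewrite mul0n leqn0 cardfs_eq0; apply/eqP/fsetP => c; rewrite !inE/= andbF.
  pose Dl := [fset (l^-1 * x)%g | x in D]%fset.
  apply: (@leq_trans #|` Dl `|`
      [fset c in F | ~~ all (fun l => (l * c)%g \in F) s]|%fset).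
    apply/fsubset_leq_card/fsubsetP => c; rewrite !inE/= negb_and => /andP[cF].
    rewrite cF /=; case/orP => [lc|->]; rewrite ?orbT//; apply/orP; left.
    apply/imfsetP; exists (l * c)%g; last by rewrite mulKg.
    rewrite !inE lc/=; apply: in_imfset2 => //=.
    by rewrite !inE sL ?orbT ?inE ?eqxx.
  rewrite cardfsU mulSn; apply: leq_trans (leq_subr _ _) (leq_add _ _).
    exact: leq_imfset_card.
  by apply: IHs => x xs; apply: sL; rewrite inE xs orbT.
apply: (@le_trans _ _ ((#|` L| * #|` D|)%N%:R)).
  by rewrite ler_nat; exact: (cB L).
rewrite natrM; apply: (@le_trans _ _ (#|` L|%:R * (q * #|` F|%:R))).
  by rewrite ler_wpM2l.
rewrite mulrA ler_wpM2r// /q mulrCA ler_piMr ?(ltW e0)//.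
by rewrite ler_pdivrMr// mul1r ler_nat.
Qed.

Definition folner_sequence (R : realType) (F : nat -> {fset G}) : Prop :=
  (forall n, F n != fset0) /\
  forall L (e : R), 0 < e -> exists N, forall n, (N <= n)%N ->
    #|` inner_boundary L (F n)|%:R <= e * #|` F n|%:R.

Lemma amenable_folner_sequence (R : realType) : countable [set: G] ->
  amenable R G -> exists F : nat -> {fset G}, folner_sequence R F.
Proof.
move=> cG am.
have [enum enumP] : exists enum : nat -> G, forall g, exists n, enum n = g.
  have /countable_injP[f f_inj] := cG.
  exists (fun n => xget 1%g [set g | f g = n]) => g; exists (f g).
  apply: f_inj; rewrite ?inE//.
  have : exists h, [set h | f h = f g] h by exists g.
  by move/(xgetPex 1%g).
pose S n := [fset enum i | i in iota 0 n]%fset.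
have SF n : exists F : {fset G}, F != fset0 /\
    #|` inner_boundary (S n) F|%:R <= n.+1%:R^-1 * #|` F|%:R :> R.
  have [|F F0 hF] := @amenable_folner R (S n) n.+1%:R^-1 am; last by exists F.
  by rewrite invr_gt0.
have [F FP] := choice SF; exists F; split=> [n|L e e0]; first by have [] := FP n.
have absorb (s : seq G) : exists N, forall n, (N <= n)%N -> {subset s <= S n}.
  elim: s => [|l s [N IHs]]; first by exists 0%N => n _ x; rewrite in_nil.
  have [k <-] := enumP l; exists (maxn N k.+1) => n; rewrite geq_max => /andP[Nn kn] x.
  rewrite inE => /predU1P[->|xs]; last exact: IHs xs.
  by apply: in_imfset; rewrite /= mem_iota.
have [N1 LS] := absorb L.
have [N2 N2e] := ltr_add_invr (R := R) (e0 : 0 < e); rewrite add0r in N2e.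
exists (maxn N1 N2) => n; rewrite geq_max => /andP[N1n N2n].
apply: (@le_trans _ _ (#|` inner_boundary (S n) (F n)|%:R)).
  rewrite ler_nat; apply/fsubset_leq_card/fsubsetP => c; rewrite !inE/=.
  case/andP=> -> /=; apply: contra => /allP h; apply/allP => l /(LS _ N1n).
  exact: h.
have [_ /le_trans] := FP n; apply; rewrite ler_wpM2r//.
by apply: le_trans (ltW N2e); rewrite lef_pV2 ?posrE// ler_nat.
Qed.

End Folner.

(** * Analytic sets *)

Section Baire.
Implicit Types (s t : nat -> nat) (D : set (nat -> nat)).

Definition agree n s t := forall i, (i < n)%N -> s i = t i.

Definition baire_closed D :=
  forall s, (forall n, exists2 t, D t & agree n s t) -> D s.

Definition baire_continuous (T : topologicalType) D (f : (nat -> nat) -> T) :=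
  forall s, D s -> forall U, nbhs (f s) U ->
    exists n, forall t, D t -> agree n s t -> U (f t).

(** Parametrizing by closed subsets of the Baire space, instead of the whole
    space, makes the empty set analytic and lets intersections be described by
    closed constraints on the parameters. *)
Definition analytic (T : topologicalType) (A : set T) :=
  exists D (f : (nat -> nat) -> T),
    [/\ baire_closed D, baire_continuous D f & f @` D = A].

Lemma agree_le m n s t : (m <= n)%N -> agree n s t -> agree m s t.
Proof. by move=> mn st i im; apply: st; exact: leq_trans im mn. Qed.

Lemma analytic_image (T U : topologicalType) (g : T -> U) (A : set T) :
  continuous g -> analytic A -> analytic (g @` A).
Proof.
move=> cg [D [f [cD cf <-]]]; exists D, (g \o f); split=> //.
  by move=> s Ds V /cg /(cf s Ds).
by rewrite image_comp.
Qed.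

Lemma analytic_bigcup (T : topologicalType) (A : nat -> set T) :
  (forall n, analytic (A n)) -> analytic (\bigcup_n A n).
Proof.
move=> /choice[D /choice[f anA]].
pose tl s i := s i.+1 : nat.
exists [set s | D (s 0%N) (tl s)], (fun s => f (s 0%N) (tl s)); split.
- move=> s cl /=; have [cD _ _] := anA (s 0%N); apply: cD => n.
  have [t /= Dt st] := cl n.+1; exists (tl t); first by rewrite (st 0%N).
  by move=> i ni; exact: st.
- move=> s /= Ds U fU; have [_ cf _] := anA (s 0%N).
  have [n nU] := cf _ Ds _ fU; exists n.+1 => t /= Dt st.
  rewrite -(st 0%N)// in Dt *; apply: nU => // i ni; exact: st.
- apply/seteqP; split=> [_ [s /= Ds <-]|x [n _]].
    by exists (s 0%N) => //; have [_ _ <-] := anA (s 0%N); exists (tl s).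
  have [_ _ <-] := anA n; move=> [s Ds <-].
  by exists (fun i => if i is j.+1 then s j else n).
Qed.

(** Through [pickle], one point of the Baire space codes a sequence of them. *)
Definition column s (n i : nat) : nat := s (choice.pickle (n, i)).

Lemma agree_column n k s t :
  agree (\max_(i < k) (choice.pickle (n, val i)).+1) s t -> agree k (column s n) (column t n).
Proof.
move=> st i ik; apply: st.
by have := @leq_bigmax _ (fun i : 'I_k => (choice.pickle (n, val i)).+1) (Ordinal ik).
Qed.

Lemma columns_surj (ss : nat -> nat -> nat) : exists s, forall n, column s n = ss n.
Proof.
exists (fun k => if choice.unpickle k is Some (n, i) then ss n i else 0%N) => n.
by apply/funext => i; rewrite /column choice.pickleK.
Qed.

Lemma baire_closed_column D n : baire_closed D -> baire_closed [set s | D (column s n)].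
Proof.
move=> cD s cl /=; apply: cD => k.
have [t Dt st] := cl (\max_(i < k) (choice.pickle (n, val i)).+1)%N.
by exists (column t n) => //; exact: agree_column.
Qed.

Lemma analytic_setX (T U : topologicalType) (A : set T) (B : set U) :
  analytic A -> analytic B -> analytic (A `*` B).
Proof.
move=> [D [f [cD cf <-]]] [E [g [cE cg <-]]].
exists [set s | D (column s 0) /\ E (column s 1)],
  (fun s => (f (column s 0), g (column s 1))); split.
- move=> s cl; split.
    by apply: (baire_closed_column (n := 0) cD) => n; have [t [? ?] ?] := cl n; exists t.
  by apply: (baire_closed_column (n := 1) cE) => n; have [t [? ?] ?] := cl n; exists t.
- move=> s [Ds Es] V [[V1 V2] /= [/(cf _ Ds)[n1 h1] /(cg _ Es)[n2 h2]] VV].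
  exists (maxn (\max_(i < n1) (choice.pickle (0%N, val i)).+1)
               (\max_(i < n2) (choice.pickle (1%N, val i)).+1)) => t [Dt Et] st.
  apply: VV; split=> /=.
    by apply: h1 => //; apply: agree_column; apply: agree_le st; exact: leq_maxl.
  by apply: h2 => //; apply: agree_column; apply: agree_le st; exact: leq_maxr.
- apply/seteqP; split=> [_ [s [Ds Es] <-]|[x y] [/= [s Ds <-] [t Et <-]]].
    by split=> /=; [exists (column s 0)|exists (column s 1)].
  have [r rP] := columns_surj (fun n => if n is 0 then s else t).
  by exists r; rewrite /= ?rP.
Qed.

(** The parameter of an intersection is a sequence of parameters with the same
    image; in a Hausdorff space this is a closed condition. *)
Lemma analytic_bigcap (T : topologicalType) (A : nat -> set T) :
  hausdorff_space T -> (forall n, analytic (A n)) -> analytic (\bigcap_n A n).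
Proof.
move=> hT /choice[D /choice[f anA]].
exists [set s | (forall n, D n (column s n)) /\
                forall n, f n (column s n) = f 0%N (column s 0)],
       (fun s => f 0%N (column s 0)).
have cf n s : D n (column s n) -> forall U, nbhs (f n (column s n)) U ->
    exists k, forall t, D n (column t n) -> agree k s t -> U (f n (column t n)).
  move=> Ds U fU; have [_ /(_ _ Ds _ fU)[k kU] _] := anA n.
  exists (\max_(i < k) (choice.pickle (n, val i)).+1)%N => t Dt st.
  by apply: kU => //; exact: agree_column.
split.
- move=> s cl.
  have Ds n : D n (column s n).
    have [cD _ _] := anA n; apply: (baire_closed_column cD) => k.
    by have [t [Dt _] st] := cl k; exists t.
  split=> // n; apply: hT => V U fV fU.
  have [k kU] := cf _ _ (Ds n) _ fV; have [l lV] := cf _ _ (Ds 0%N) _ fU.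
  have [t [Dt ft] st] := cl (maxn k l); exists (f n (column t n)); split.
    by apply: kU => //; apply: agree_le st; exact: leq_maxl.
  by rewrite ft; apply: lV => //; apply: agree_le st; exact: leq_maxr.
- by move=> s [Ds _] U fU; have [k kU] := cf _ _ (Ds 0%N) _ fU; exists k => t [Dt _]; exact: kU.
- apply/seteqP; split=> [_ [s [Ds fs] <-] n _|x Ax].
    by have [_ _ <-] := anA n; exists (column s n).
  have /choice[ss ssP] n : exists s, D n s /\ f n s = x.
    by have := Ax n Logic.I; have [_ _ <-] := anA n; move=> [s Ds <-]; exists s.
  have [s sP] := columns_surj ss.
  exists s; rewrite /= ?sP; last by have [_] := ssP 0%N.
  by split=> n; rewrite !sP; have [Dn fn] := ssP n; have [_ f0] := ssP 0%N; rewrite ?fn ?f0.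
Qed.

Lemma analytic_setI_closed (T : topologicalType) (A K : set T) :
  closed K -> analytic A -> analytic (A `&` K).
Proof.
move=> cK [D [f [cD cf <-]]]; exists [set s | D s /\ K (f s)], f; split.
- move=> s cl; have Ds : D s.
    by apply: cD => n; have [t [Dt _] st] := cl n; exists t.
  split=> //; apply: cK => U /(cf _ Ds)[n nU].
  by have [t [Dt Kt] st] := cl n; exists (f t); split=> //; exact: nU.
- by move=> s [Ds _] U /(cf _ Ds)[n nU]; exists n => t [Dt _]; exact: nU.
- apply/seteqP; split=> [_ [s [Ds Ks] <-]|x [[s Ds <-] Ks]]; first by split=> //; exists s.
  by exists s.
Qed.

Lemma sigma_algebra_bianalytic (T : topologicalType) :
  hausdorff_space T -> analytic [set: T] ->
  sigma_algebra setT [set A : set T | analytic A /\ analytic (~` A)].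
Proof.
move=> hT anT; split.
- split; last by rewrite setC0.
  by have [D [f _]] := anT; exists set0, f; split; rewrite ?image_set0// => s /(_ 0%N)[].
- by move=> A [anA anCA]; rewrite /= setTD setCK.
- move=> A anA /=; split; first by apply: analytic_bigcup => n; have [] := anA n.
  by rewrite setC_bigcup; apply: analytic_bigcap => // n; have [] := anA n.
Qed.

End Baire.

Lemma hausdorff_prod (T U : topologicalType) :
  hausdorff_space T -> hausdorff_space U -> hausdorff_space (T * U)%type.
Proof.
move=> hT hU [x1 x2] [y1 y2] xy; congr pair.
  apply: hT => V W Vx Wy.
  have [] := xy (V `*` setT) (W `*` setT).
  - by exists (V, setT) => //; split=> //; exact: filterT.
  - by exists (W, setT) => //; split=> //; exact: filterT.
  - by move=> [z1 z2] [[Vz _] [Wz _]]; exists z1.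
apply: hU => V W Vx Wy.
have [] := xy (setT `*` V) (setT `*` W).
- by exists (setT, V) => //; split=> //; exact: filterT.
- by exists (setT, W) => //; split=> //; exact: filterT.
- by move=> [z1 z2] [[_ Vz] [_ Wz]]; exists z2.
Qed.

Section PolishAnalytic.
Variables (R : realType) (T : ptopologicalType).
Hypothesis polishT : polish R T.

Lemma polish_hausdorff : hausdorff_space T.
Proof.
have [_ [dist [[d0 dE dC dD] nbE _]]] := polishT.
move=> x y xy; apply/dE/eqP; rewrite eq_le d0 andbT leNgt; apply/negP => dxy.
have ball_nbhs z : nbhs z [set w | dist z w < dist x y / 2].
  by rewrite nbE; exists (dist x y / 2) => //=; rewrite divr_gt0.
have [z [/= xz yz]] := xy _ _ (ball_nbhs x) (ball_nbhs y).
have := dD x z y; rewrite (dC z y) leNgt => /negP; apply; lra.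
Qed.

(** A point is coded by the indices of a rapidly converging sequence from a dense
    sequence: the condition on the code is closed, and completeness provides the
    point. *)
Lemma polish_analytic : analytic [set: T].
Proof.
have [[Q cQ dQ] [dist [[d0 dE dC dD] nbE cpl]]] := polishT.
have [q qP] : exists q : nat -> T, forall x (e : R), 0 < e -> exists n, dist x (q n) < e.
  have /countable_injP[f f_inj] := cQ.
  exists (fun n => xget point [set x | Q x /\ f x = n]) => x e e0.
  have [|y [/interior_subset/= xy Qy]] := dQ [set y | dist x y < e]^° _ (open_interior _).
    by exists x; rewrite /interior/= nbE; exists e.
  exists (f y); set z := xget _ _.
  have [Qz fz] : Q z /\ f z = f y.
    by apply: (xgetPex point (P := fun x => Q x /\ f x = f y)); exists y.
  by have -> : z = y by apply: f_inj; rewrite ?inE.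
pose r (n : nat) : R := n.+1%:R^-1.
have r0 n : 0 < r n by rewrite invr_gt0.
have rle n m : (n <= m)%N -> r m <= r n by move=> nm; rewrite lef_pV2 ?posrE// ler_nat.
have rlt (e : R) : 0 < e -> exists n, r n < e.
  by move=> e0; have [n] := ltr_add_invr e0; rewrite add0r => ne; exists n.
(* two terms within [r n] and [r m] of a common limit are within [r n *+ 2] *)
pose D := [set s : nat -> nat |
  forall n m, (n <= m)%N -> dist (q (s n)) (q (s m)) <= r n *+ 2].
pose f (s : nat -> nat) : T := xget point [set l : T | (fun n => q (s n)) @ \oo --> l].
have fD s n : D s -> dist (q (s n)) (f s) <= r n *+ 2.
  move=> Ds; have /(xgetPex point) : exists l : T, [set l : T | (fun n => q (s n)) @ \oo --> l] l.
    apply: cpl => e e0; have [N Ne] := rlt (e / 4) (divr_gt0 e0 (ltr0n _ 4)).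
    exists N => i j Ni Nj; apply: le_lt_trans (dD _ (q (s N)) _) _.
    have := Ds _ _ Nj; have := Ds _ _ Ni; rewrite dC !mulr2n; lra.
  rewrite /= -/(f s) => sf; apply/ler_addgt0Pr => e e0.
  have [N _ Ne] : \forall k \near \oo, dist (f s) (q (s k)) < e.
    by apply: (sf [set y | dist (f s) y < e]); rewrite nbE; exists e.
  apply: le_trans (dD _ (q (s (maxn n N))) _) _; apply: lerD.
    by apply: Ds; exact: leq_maxl.
  by rewrite dC ltW//; apply: Ne => /=; exact: leq_maxr.
exists D, f; split.
- move=> s cl n m nm; have [t Dt st] := cl m.+1.
  by rewrite !st ?ltnS//; exact: Dt.
- move=> s Ds U; rewrite nbE => -[e /= e0 eU].
  have [n ne] := rlt (e / 4) (divr_gt0 e0 (ltr0n _ 4)).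
  exists n.+1 => t Dt st; apply: eU => /=.
  apply: le_lt_trans (dD _ (q (s n)) _) _.
  have := fD _ n Dt; rewrite -st//; have := fD _ n Ds; rewrite dC !mulr2n; lra.
- apply/seteqP; split=> // x _.
  have /choice[s sx] n : exists k, dist x (q k) < r n by exact: qP.
  have Ds : D s.
    move=> n m nm; apply: le_trans (dD _ x _) _.
    by rewrite mulr2n lerD// ?(dC _ x) ltW//; apply: lt_le_trans (sx m) (rle _ _ nm).
  exists s => //; apply/dE/eqP; rewrite eq_le d0 andbT.
  apply/ler_addgt0Pr => e e0; rewrite add0r.
  have [n ne] := rlt (e / 4) (divr_gt0 e0 (ltr0n _ 4)).
  apply: le_trans (dD _ (q (s n)) _) _.
  have := fD _ n Ds; have := sx n; rewrite (dC _ x) (dC _ (f s)) mulr2n; lra.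
Qed.

Lemma closed_analytic (K : set T) : closed K -> analytic K.
Proof.
by move=> cK; rewrite -(setTI K); apply: analytic_setI_closed => //; exact: polish_analytic.
Qed.

Lemma open_analytic (U : set T) : open U -> analytic U.
Proof.
have [_ [dist [[d0 dE dC dD] nbE _]]] := polishT => oU.
pose K n := [set x | forall y, ~ U y -> n.+1%:R^-1 <= dist x y].
have -> : U = \bigcup_n K n.
  apply/seteqP; split=> [x Ux|x [n _ Kx]].
    have : nbhs x U by apply: open_nbhs_nbhs.
    rewrite nbE => -[e /= e0 eU].
    have [n ne] := ltr_add_invr e0; exists n => // y Uy; rewrite leNgt.
    apply/negP => xy; apply: Uy; apply: eU => /=.
    by apply: lt_trans xy _; rewrite -[ltLHS]add0r.
  apply: contrapT => /Kx; rewrite (dE x x).2// leNgt => /negP; apply.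
  by rewrite invr_gt0.
apply: analytic_bigcup => n; apply: closed_analytic => x clx y Uy.
apply/ler_addgt0Pr => e e0; have [|z [Kz /= xz]] := clx [set z | dist x z < e].
  by rewrite nbE; exists e.
apply: le_trans (Kz _ Uy) _; apply: le_trans (dD _ x _) _.
by rewrite addrC lerD2l dC ltW.
Qed.

Lemma analytic_measurable (A : set (borel T)) : measurable A -> analytic (A : set T).
Proof.
move=> mA; suff [] : analytic (A : set T) /\ analytic (~` A : set T) by [].
move: A mA; apply: smallest_sub.
  exact: (sigma_algebra_bianalytic polish_hausdorff polish_analytic).
by move=> A oA; split; [exact: open_analytic|apply/closed_analytic/open_closedC].
Qed.

Lemma analytic_measurable_prod (E : set (borel T * borel T)) :
  measurable E -> analytic (E : set (T * T)%type).
Proof.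
move=> mE; suff [] : analytic (E : set (T * T)%type) /\
  analytic (~` E : set (T * T)%type) by [].
have aTT : analytic [set: (T * T)%type].
  by rewrite -setXTT; apply: analytic_setX; exact: polish_analytic.
have sTT := sigma_algebra_bianalytic (hausdorff_prod polish_hausdorff polish_hausdorff) aTT.
move: E mE; rewrite measurable_prod_measurableType.
apply: smallest_sub => // _ [A mA [B mB <-]]; split.
  by apply: analytic_setX; exact: analytic_measurable.
have -> : ~` (A `*` B) = \bigcup_n (if n is 0 then ~` A `*` setT else setT `*` ~` B).
  apply/seteqP; split=> [[x y]|[x y] [[|n] _ []]] /=.
  - by move=> /not_andP[Ax|By]; [exists 0%N|exists 1%N].
  - by move=> Ax _ [].
  - by move=> _ By [].
apply: analytic_bigcup => -[|n]; apply: analytic_setX; try exact: polish_analytic.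
  by apply: analytic_measurable; exact: measurableC.
by apply: analytic_measurable; exact: measurableC.
Qed.

End PolishAnalytic.

(** * Separation of analytic sets *)

Section Separation.
Variable T : ptopologicalType.
Implicit Types A B C : set T.

Definition borel_separated A B :=
  exists C, [/\ measurable (C : set (borel T)), A `<=` C & C `&` B = set0].

Lemma borel_separated_bigcup (A B : nat -> set T) :
  (forall i j, borel_separated (A i) (B j)) ->
  borel_separated (\bigcup_i A i) (\bigcup_j B j).
Proof.
move=> sepAB.
have /choice[C CP] i : exists Ci : nat -> set T, forall j,
    [/\ measurable (Ci j : set (borel T)), A i `<=` Ci j & Ci j `&` B j = set0].
  by have /choice[Ci CiP] := sepAB i; exists Ci.
exists (\bigcup_i \bigcap_j C i j); split.
- apply: bigcupT_measurable => i; apply: bigcapT_measurable => j.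
  by have [] := CP i j.
- by move=> x [i _ Ax]; exists i => // j _; have [_ sAC _] := CP i j; exact: sAC.
- rewrite -subset0 => x [[i _ Cx] [j _ Bx]].
  by have [_ _ <-] := CP i j; split=> //; exact: Cx.
Qed.

(** Lusin's theorem. If [f @` D] and [g @` E] cannot be separated, then one can
    refine cylinders around some [s] and [t] step by step while keeping their
    images inseparable; but by continuity these images eventually lie in disjoint
    neighbourhoods of [f s] and [g t]. *)
Theorem analytic_separation A B : hausdorff_space T ->
  analytic A -> analytic B -> A `&` B = set0 -> borel_separated A B.
Proof.
move=> hT [D [f [cD cf <-]]] [E [g [cE cg <-]]] disj; apply: contrapT => nsep.
pose cyl (D' : set (nat -> nat)) n s := [set t : nat -> nat | D' t /\ agree n s t].
pose upd s (n k i : nat) : nat := if i == n then k else s i.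
have cylS (D' : set (nat -> nat)) n s : cyl D' n s = \bigcup_k cyl D' n.+1 (upd s n k).
  apply/seteqP; split=> [t [Dt st]|t [k _ [Dt st]]].
    exists (t n) => //; split=> // i; rewrite ltnS leq_eqVlt /upd => /predU1P[->|ni].
      by rewrite eqxx.
    by rewrite ltn_eqF//; exact: st.
  split=> // i ni; rewrite -st ?ltnS ?(ltnW ni)//.
  by rewrite /upd ltn_eqF.
pose bad n (st : (nat -> nat) * (nat -> nat)) :=
  ~ borel_separated (f @` cyl D n st.1) (g @` cyl E n st.2).
have step (n : nat) (st : (nat -> nat) * (nat -> nat)) : exists kl : nat * nat,
    bad n st -> bad n.+1 (upd st.1 n kl.1, upd st.2 n kl.2).
  have [bst|] := pselect (bad n st); last by exists (0%N, 0%N).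
  apply: contrapT => /forallNP all_sep; apply: bst.
  rewrite !cylS !image_bigcup; apply: borel_separated_bigcup => k l.
  by apply: contrapT => b; apply: (all_sep (k, l)).
have /choice[kl klP] : forall n, exists kl : (nat -> nat) * (nat -> nat) -> nat * nat,
    forall st, bad n st -> bad n.+1 (upd st.1 n (kl st).1, upd st.2 n (kl st).2).
  by move=> n; have [h hP] := choice (step n); exists h.
pose st := fix st n := if n is m.+1 then
  (upd (st m).1 m (kl m (st m)).1, upd (st m).2 m (kl m (st m)).2)
  else (fun=> 0%N, fun=> 0%N).
have st_bad n : bad n (st n).
  elim: n => [|n IHn]; last exact: klP.
  rewrite /bad /=; have cyl0 D' : cyl D' 0 (fun=> 0%N) = D'.
    by apply/seteqP; split=> [t []|t Dt].
  by rewrite !cyl0.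
pose s i := (st i.+1).1 i; pose t i := (st i.+1).2 i.
have st1 n : agree n (st n).1 s /\ agree n (st n).2 t.
  elim: n => [//|n [IH1 IH2]]; split=> i; rewrite ltnS leq_eqVlt => /predU1P[->//|ni].
    by rewrite /= /upd ltn_eqF//; exact: IH1.
  by rewrite /= /upd ltn_eqF//; exact: IH2.
have bad_st n : bad n (s, t).
  have [s1 t1] := st1 n; have := st_bad n; rewrite /bad/=.
  have cylE D' u v : agree n u v -> cyl D' n u = cyl D' n v.
    move=> uv; apply/seteqP; split=> w [Dw uw]; split=> // i ni.
      by rewrite -uv// uw.
    by rewrite uv// uw.
  by rewrite (cylE _ _ _ s1) (cylE _ _ _ t1).
have Ds : D s.
  apply: cD => n; apply: contrapT => noD; apply: (bad_st n).
  exists set0; split; [exact: measurable0| |by rewrite set0I].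
  by move=> ? [u [Du su] _]; apply: noD; exists u.
have Et : E t.
  apply: cE => n; apply: contrapT => noE; apply: (bad_st n).
  exists setT; split; [exact: measurableT|by []|rewrite setTI -subset0].
  by move=> ? [u [Eu tu] _]; apply: noE; exists u.
have fg : f s != g t.
  apply/eqP => fg; have : (f @` D `&` g @` E) (f s).
    by split; [exists s|rewrite fg; exists t].
  by rewrite disj.
move: hT; rewrite open_hausdorff => /(_ _ _ fg)[[U V] /=].
move=> [/set_mem/= Uf /set_mem/= Vg] [/= oU oV /eqP UV].
have [n nU] := cf _ Ds _ (open_nbhs_nbhs (conj oU Uf)).
have [m mV] := cg _ Et _ (open_nbhs_nbhs (conj oV Vg)).
apply: (bad_st (maxn n m)); exists U; split.
- exact: sub_sigma_algebra.
- move=> _ [u [/= Du su] <-]; apply: nU => //.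
  by apply: agree_le su; exact: leq_maxl.
- rewrite -subset0 => z [Uy [u [Eu tu] uy]]; rewrite -UV -uy; split; first by rewrite uy.
  by apply: mV => //; apply: agree_le tu; exact: leq_maxr.
Qed.

End Separation.

(** The saturation of a Borel set is analytic, so Lusin's theorem can be applied to
    it, and applied repeatedly: a Borel set disjoint from the saturation of [B1]
    has a saturation that is still disjoint from it, hence is contained in a larger
    Borel set with the same property. *)
Theorem saturated_separation (R : realType) (T : ptopologicalType)
    (E : set (borel T * borel T)) (B0 B1 : set (borel T)) :
  polish R T -> countable_borel_equivalence E ->
  measurable B0 -> measurable B1 ->
  (forall x y, B0 x -> B1 y -> ~ E (x, y)) ->
  exists C, [/\ saturated_sets E C, B0 `<=` C & C `&` B1 = set0].
Proof.
move=> pT [mE Er Es Et _] mB0 mB1 B01.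
pose sat (C : set (borel T)) : set (borel T) := snd @` (E `&` C `*` setT).
have sat_analytic C : measurable C -> analytic (sat C : set T).
  move=> mC; have := @analytic_measurable_prod R T pT (E `&` C `*` setT).
  move=> /(_ (measurableI _ _ mE (measurableX mC measurableT))).
  by apply: analytic_image => -[x y]; exact: cvg_snd.
have next C : exists C', measurable C -> C `&` sat B1 = set0 ->
    [/\ measurable C', sat C `<=` C' & C' `&` sat B1 = set0].
  have [mC|?] := pselect (measurable C); last by exists set0.
  have [CB|?] := pselect (C `&` sat B1 = set0); last by exists set0.
  have [|C' [mC' CC' C'B]] := @analytic_separation T _ _ (polish_hausdorff pT)
    (sat_analytic _ mC) (sat_analytic _ mB1); last by exists C'.
  rewrite -subset0 => y [[[x y'] [/= Exy [Cx _]] yE] [[z z'] [/= Ezy [Bz _]] zE]].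
  suff : (C `&` sat B1) x by rewrite CB.
  split; first exact: Cx.
  exists (z, x) => //; split=> //=; apply: Et (Es _ _ Exy).
  by rewrite yE -zE.
have [nx nxP] := choice next.
pose C n := iter n nx B0.
have CP n : measurable (C n) /\ C n `&` sat B1 = set0.
  elim: n => [|n [mC CB]]; last by have [] := nxP _ mC CB.
  split=> //; rewrite -subset0 => x [Bx [[y x'] [/= Eyx [By _]] xx]].
  by apply: (B01 _ _ Bx By); apply: Es; rewrite -xx.
have satC n : sat (C n) `<=` C n.+1.
  by have [mC CB] := CP n; have [] := nxP _ mC CB.
exists (\bigcup_n C n); split.
- split; first by apply: bigcupT_measurable => n; have [] := CP n.
  apply/seteqP; split=> [x Cx|y [x [n _ Cx] Exy]]; first by exists x => //; exact: Er.
  by exists n.+1 => //; apply: satC; exists (x, y).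
- by move=> x Bx; exists 0%N.
- rewrite -subset0 => x [[n _ Cx] Bx]; have [_ CB] := CP n.
  by have : (C n `&` sat B1) x; [split=> //; exists (x, x)|rewrite CB].
Qed.

(** * Nonsingular actions and their derivatives *)

Section ChangeOfVariables.
Context d d' (S : measurableType d) (Y : measurableType d') (R : realType).
Variables (m : {measure set S -> \bar R}) (nu : {measure set Y -> \bar R}).
Variables (phi : S -> Y) (w : S -> R).
Hypotheses (mphi : measurable_fun setT phi) (mw : measurable_fun setT w)
  (w0 : forall x, 0 <= w x).

Import HBNNSimple.
Local Open Scope ereal_scope.

Lemma integral_density_pushforward (f : Y -> \bar R) :
  (forall C, measurable C -> \int[m]_(x in phi @^-1` C) (w x)%:E = nu C) ->
  measurable_fun setT f -> (forall y, 0 <= f y) ->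
  \int[m]_x (f (phi x) * (w x)%:E) = \int[nu]_y f y.
Proof.
move=> wnu mf f0; pose g := nnsfun_approx measurableT mf.
have mwE : measurable_fun setT (EFin \o w) by exact/measurable_EFinP.
have g_cvg y : EFin \o g^~ y @ \oo --> f y by exact: cvg_nnsfun_approx.
have -> : \int[nu]_y f y = lim (\int[nu]_y (g n y)%:E @[n --> \oo]).
  under eq_integral do rewrite -(cvg_lim _ (g_cvg _))//.
  apply: monotone_convergence => //.
  - by move=> n; exact/measurable_EFinP.
  - by move=> n y _; rewrite lee_fin.
  - by move=> y _ a b ab; rewrite lee_fin; exact/lefP/nd_nnsfun_approx.
have -> : \int[m]_x (f (phi x) * (w x)%:E) =
    lim (\int[m]_x ((g n (phi x))%:E * (w x)%:E) @[n --> \oo]).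
  have fg x : f (phi x) * (w x)%:E = lim ((g n (phi x))%:E * (w x)%:E @[n --> \oo]).
    by apply/esym/cvg_lim => //; apply: cvgeZr => //; exact: g_cvg.
  under eq_integral do rewrite fg.
  apply: monotone_convergence => //.
  - by move=> n; apply: emeasurable_funM => //; apply/measurable_EFinP/measurableT_comp.
  - by move=> n x _; rewrite mule_ge0 ?lee_fin.
  - move=> x _ a b ab; rewrite lee_wpmul2r ?lee_fin//.
    exact/lefP/nd_nnsfun_approx.
congr (lim _); apply: congr2 => //; apply/funext => n.
have term0 (r : R) (y : Y) : 0 <= (r * \1_(g n @^-1` [set r]) y)%:E.
  exact: nnfun_muleindic_ge0.
have mterm (r : R) : measurable_fun setT (fun y => (r * \1_(g n @^-1` [set r]) y)%:E).
  by apply/measurable_EFinP; exact: measurable_funM.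
have gE y : (g n y)%:E = \sum_(r \in range (g n)) (r * \1_(g n @^-1` [set r]) y)%:E.
  by rewrite fimfunE -fsumEFin.
under eq_integral do rewrite gE ge0_mule_fsuml//.
under [RHS]eq_integral do rewrite gE.
rewrite !ge0_integral_fsum//; last 2 first.
- by move=> r; apply: emeasurable_funM => //; apply: (measurableT_comp (mterm r)).
- by move=> r x _; rewrite mule_ge0 ?lee_fin// -lee_fin.
apply: eq_fsbigr => r _; set C := g n @^-1` [set r].
have mC : measurable C.
  by rewrite -(setTI C); exact: (measurable_funP (g n)).
have [r0|r0] := ltP r 0%R.
  have C0 : C = set0.
    by apply/seteqP; split=> // y /= gr; have : (0 <= g n y)%R by []; rewrite gr leNgt r0.
  rewrite !integral0_eq// => x _; rewrite C0 indicE in_set0 mulr0 ?mul0e//.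
rewrite integralZl_indic_nnsfun// integral_indic// setIT -wnu//.
under eq_integral do rewrite EFinM -muleA.
rewrite ge0_integralZl//; last 2 first.
- apply: emeasurable_funM => //; apply/measurable_EFinP.
  by apply: measurableT_comp => //; exact: measurable_indic.
- by move=> x _; rewrite mule_ge0 ?lee_fin.
congr (_ * _); rewrite [RHS]integral_mkcond; apply: eq_integral => x _.
rewrite patchE indicE; have [Cx|Cx] := pselect (C (phi x)).
  by rewrite !mem_set// mul1e.
by rewrite !memNset// mul0e.
Qed.

End ChangeOfVariables.

Lemma countable_ae (R : realType) d (Y : measurableType d)
    (nu : {measure set Y -> \bar R}) (I : Type) (P : I -> Y -> Prop) :
  countable [set: I] -> (forall i, {ae nu, forall y, P i y}) ->
  {ae nu, forall y, forall i, P i y}.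
Proof.
move=> /countable_injP[f f_inj] Pae.
have : {ae nu, forall y, forall n i, f i = n -> P i y}.
  apply: ae_foralln => n; have [[i fi]|nfi] := pselect (exists i, f i = n).
    apply: filterS (Pae i) => y Py j fj.
    by rewrite (f_inj j i)// ?inE ?fi.
  by apply: aeW => y i fi; exfalso; apply: nfi; exists i.
by apply: filterS => y Py i; exact: (Py (f i)).
Qed.

Section BorelActions.
Context (G : groupType) d (Y : measurableType d) (T : G -> Y -> Y).
Hypothesis Tact : borel_action T.

Lemma borel_actionK g : cancel (T g) (T g^-1%g) /\ cancel (T g^-1%g) (T g).
Proof.
by have [act1 actM _] := Tact; split=> y; rewrite -actM ?mulVg ?mulgV act1.
Qed.

Lemma invariant_setP (B : set Y) :
  (forall g, T g @` B = B) -> forall g y, B (T g y) <-> B y.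
Proof.
move=> TB g y; split=> [|By]; last by rewrite -(TB g); exists y.
rewrite -{1}(TB g) => -[y' By' yy']; have [gK _] := borel_actionK g.
by rewrite -(gK y) -yy' gK.
Qed.

Lemma image_action g (A : set Y) : T g @` A = T g^-1%g @^-1` A.
Proof.
have [gK gVK] := borel_actionK g; apply/seteqP; split=> [_ [y Ay <-]|y Ay].
  by rewrite /= gK.
by exists (T g^-1%g y).
Qed.

Lemma measurable_image_action g (A : set Y) : measurable A -> measurable (T g @` A).
Proof.
move=> mA; rewrite image_action; have [_ _ mT] := Tact.
by rewrite -[X in measurable X]setTI; exact: mT.
Qed.

End BorelActions.

Section ActionWithDensity.
Context (R : realType) d (Y : measurableType d) (G : groupType).
Variables (nu : probability Y R) (T : G -> Y -> Y) (w : G -> Y -> R).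

(** The derivative is specified through the change of variables formula for all
    nonnegative functions: in this form it passes to products by Tonelli's
    theorem. *)
Definition action_with_density :=
  [/\ borel_action T,
      forall g, measurable_fun [set: Y] (w g),
      forall g y, 0 <= w g y &
      forall g (f : Y -> \bar R), measurable_fun [set: Y] f ->
        (forall y, (0 <= f y)%E) ->
        (\int[nu]_y (f (T g y) * (w g y)%:E) = \int[nu]_y f y)%E].

Hypothesis Tw : action_with_density.

Lemma measurable_action g : measurable_fun [set: Y] (T g).
Proof. by have [[_ _ mT] _ _ _] := Tw. Qed.

Lemma measurable_density g : measurable_fun [set: Y] (w g).
Proof. by have [_ mw _ _] := Tw. Qed.

Lemma density_ge0 g y : 0 <= w g y. Proof. by have [_ _ w0 _] := Tw. Qed.

Lemma actM g h y : T (g * h)%g y = T g (T h y).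
Proof. by have [[_ + _] _ _ _] := Tw. Qed.

Lemma act1 y : T 1%g y = y. Proof. by have [[+ _ _] _ _ _] := Tw. Qed.

Lemma actK g y : T g^-1%g (T g y) = y. Proof. by rewrite -actM mulVg act1. Qed.

Lemma actVK g y : T g (T g^-1%g y) = y. Proof. by rewrite -actM mulgV act1. Qed.

Local Open Scope ereal_scope.

Lemma integral_action g (f : Y -> \bar R) :
  measurable_fun [set: Y] f -> (forall y, 0 <= f y) ->
  \int[nu]_y (f (T g y) * (w g y)%:E) = \int[nu]_y f y.
Proof. by have [_ _ _ cv] := Tw; exact: cv. Qed.

Lemma measurable_comp_action g (f : Y -> \bar R) :
  measurable_fun [set: Y] f -> measurable_fun [set: Y] (fun y => f (T g y)).
Proof. by move=> mf; apply: (measurableT_comp mf); exact: measurable_action. Qed.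

Lemma integral_comp_action g (f : Y -> \bar R) :
  measurable_fun [set: Y] f -> (forall y, 0 <= f y) ->
  \int[nu]_y f (T g y) = \int[nu]_y (f y * (w g^-1%g y)%:E).
Proof.
move=> mf f0; rewrite -(integral_action g^-1%g)//; last exact: measurable_comp_action.
by apply: eq_integral => y _; rewrite actVK.
Qed.

Lemma ae_eq_density (f g : Y -> R) :
  measurable_fun [set: Y] f -> measurable_fun [set: Y] g ->
  (forall y, (0 <= f y)%R) -> (forall y, (0 <= g y)%R) ->
  \int[nu]_y (f y)%:E < +oo ->
  (forall A, measurable A ->
    \int[nu]_y ((\1_A y)%:E * (f y)%:E) = \int[nu]_y ((\1_A y)%:E * (g y)%:E)) ->
  {ae nu, forall y, f y = g y}.
Proof.
move=> mf mg f0 g0 fi fg.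
have indicM (h : Y -> R) A : \int[nu]_(y in A) (h y)%:E = \int[nu]_y ((\1_A y)%:E * (h y)%:E).
  rewrite integral_mkcond; apply: eq_integral => y _; rewrite patchE indicE.
  by case: ifPn => _; rewrite ?mul1e ?mul0e.
have : ae_eq nu setT (EFin \o f) (EFin \o g).
  apply: integral_ae_eq => //.
  - apply/integrableP; split; first exact/measurable_EFinP.
    by under eq_integral do rewrite /= ger0_norm//.
  - exact/measurable_EFinP.
  - by move=> A _ mA /=; rewrite (indicM f A) (indicM g A) fg.
by apply: filterS => y /(_ Logic.I)[].
Qed.

Lemma integral_density g : \int[nu]_y (w g y)%:E = 1.
Proof.
rewrite -(mul1e 1) -[X in 1 * X](probability_setT nu).
rewrite -(integral_cst nu measurableT 1) -(integral_action g (f := cst 1))//.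
by apply: eq_integral => y _; rewrite /= mul1e.
Qed.

(** Both sides are densities of [A |-> nu (T (g * h) @` A)], computed in one or in two
    steps. *)
Lemma density_cocycle g h : {ae nu, forall y, w (g * h)%g y = (w g (T h y) * w h y)%R}.
Proof.
have mwT : measurable_fun [set: Y] (fun y => w g (T h y)).
  by apply: (measurableT_comp (measurable_density g)); exact: measurable_action.
apply: ae_eq_density => //.
- exact: measurable_density.
- by apply: measurable_funM => //; exact: measurable_density.
- by move=> y; exact: density_ge0.
- by move=> y; rewrite mulr_ge0 ?density_ge0.
- by rewrite integral_density ltry.
move=> A mA; pose f y := (\1_A (T (g * h)^-1%g y))%:E : \bar R.
have mf : measurable_fun [set: Y] f.
  by apply/measurable_EFinP/measurableT_comp => //; exact: measurable_action.
have f0 y : 0 <= f y by rewrite lee_fin.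
transitivity (\int[nu]_y f y).
  by rewrite -(integral_action (g * h)%g (f := f))//; apply: eq_integral => y _; rewrite /f actK.
rewrite -(integral_action g (f := f))//.
rewrite -(integral_action h (f := fun y => f (T g y) * (w g y)%:E)); last 2 first.
- by apply: emeasurable_funM; [exact: measurable_comp_action|
    apply/measurable_EFinP; exact: measurable_density].
- by move=> y; rewrite mule_ge0 ?lee_fin ?density_ge0.
by apply: eq_integral => y _; rewrite /f -(actM g h) actK EFinM muleA.
Qed.

Lemma density_one : {ae nu, forall y, w 1%g y = 1%R}.
Proof.
apply: ae_eq_density => //; first exact: measurable_density.
- by move=> y; exact: density_ge0.
- by rewrite integral_density ltry.
move=> A mA; pose f y := (\1_A y)%:E : \bar R.
have mf : measurable_fun [set: Y] f by exact/measurable_EFinP.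
transitivity (\int[nu]_y f y); last by apply: eq_integral => y _; rewrite mule1.
rewrite -(integral_action 1%g (f := f))//; last by move=> y; rewrite lee_fin.
by apply: eq_integral => y _; rewrite act1.
Qed.

(** Positivity and the chain rule, which the derivatives satisfy only almost
    everywhere. *)
Definition regular_point y :=
  (forall g, (0 < w g y)%R) /\ forall g h, w (g * h)%g y = (w g (T h y) * w h y)%R.

Lemma ae_regular : countable [set: G] -> {ae nu, forall y, regular_point y}.
Proof.
move=> cG.
have coc : {ae nu, forall y, forall g h, w (g * h)%g y = (w g (T h y) * w h y)%R}.
  by do 2 apply: countable_ae => // ?; exact: density_cocycle.
apply: filterS2 coc density_one => y coc w1; split=> [g|g h]; last exact: coc.
rewrite lt0r density_ge0 andbT; apply/eqP => wg0.
by have := coc g^-1%g g; rewrite mulVg w1 wg0 mulr0 => /eqP; rewrite oner_eq0.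
Qed.
End ActionWithDensity.

(** * Averages over Folner sets *)

Lemma sume_const_seq (R : realType) (I : Type) (s : seq I) (e : \bar R) :
  (\sum_(i <- s) e = (size s)%:R%:E * e)%E.
Proof.
elim: s => [|i s IHs]; first by rewrite big_nil mul0e.
by rewrite big_cons IHs /= -natr1 addrC EFinD ge0_muleDl ?lee_fin// mul1e.
Qed.

Lemma sum_fset_inj_le (R : numDomainType) (I J : choiceType) (A : {fset I})
    (B : {fset J}) (h : I -> J) (f : J -> R) :
  injective h -> (forall i, i \in A -> h i \in B) -> (forall j, 0 <= f j) ->
  \sum_(i <- A) f (h i) <= \sum_(j <- B) f j.
Proof.
move=> h_inj hAB f0; rewrite [leRHS](big_fsetID _ (mem (h @` A)%fset))/=.
have -> : [fset x in B | x \in (h @` A)%fset]%fset = (h @` A)%fset.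
  apply/fsetP => j; rewrite !inE/= andbC; apply/andP/idP => [[]//|jA]; split=> //.
  by have /imfsetP[i /= iA ->] := jA; exact: hAB.
rewrite big_imfset/=; last by move=> x y _ _; exact: h_inj.
by rewrite lerDl sumr_ge0.
Qed.

Section FolnerAverage.
Context (R : realType) d (Y : measurableType d) (G : groupType).
Variables (T : G -> Y -> Y) (w : G -> Y -> R).
Implicit Types (F : {fset G}) (phi psi : Y -> R).

Definition total_weight F c y := \sum_(k <- F) w (k * c^-1)%g y.

(** Hopf's ratio average along the finite piece [F * c^-1] of the orbit. *)
Definition ratio_average F c phi y :=
  (\sum_(g <- F) w (g * c^-1)%g y * phi (T (g * c^-1)%g y)) / total_weight F c y.

(** Identify [F] with the finite piece of the orbit in which the base point has
    position [c], for [c] uniform in [F]. On [Y * F] this is the conditional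
    expectation with respect to a finite equivalence relation, which is why it
    is an integral preserving operator. *)
Definition folner_average F phi y :=
  #|` F|%:R^-1 * \sum_(c <- F) ratio_average F c phi y.

Variable nu : probability Y R.
Hypothesis Tw : action_with_density nu T w.
Hypothesis cG : countable [set: G].

Lemma total_weight_gt0 F c y : F != fset0 -> regular_point T w y -> 0 < total_weight F c y.
Proof.
move=> /fset0Pn[k kF] [w_gt0 _]; rewrite /total_weight (big_rem k)//=.
by rewrite ltr_pwDl ?w_gt0// sumr_ge0// => *; exact/ltW/w_gt0.
Qed.

Lemma total_weight_ge0 F c y : 0 <= total_weight F c y.
Proof. by apply: sumr_ge0 => *; exact: (density_ge0 Tw). Qed.

Lemma measurable_total_weight F c : measurable_fun [set: Y] (total_weight F c).
Proof. by apply: measurable_sum => k; exact: (measurable_density Tw). Qed.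

Lemma measurable_total_weightV F c :
  measurable_fun [set: Y] (fun y => (total_weight F c y)^-1).
Proof.
have -> : (fun y => (total_weight F c y)^-1) = (fun y => total_weight F c y `^ (-1)).
  by apply/funext => y; rewrite powR_inv1 ?total_weight_ge0.
by apply: (measurableT_comp (measurable_powR _)); exact: measurable_total_weight.
Qed.

Lemma measurable_folner_average F phi :
  measurable_fun [set: Y] phi -> measurable_fun [set: Y] (folner_average F phi).
Proof.
move=> mphi; apply: measurable_funM => //; apply: measurable_sum => c.
apply: measurable_funM; last exact: measurable_total_weightV.
apply: measurable_sum => g; apply: measurable_funM; first exact: (measurable_density Tw).
by apply: (measurableT_comp mphi); exact: (measurable_action Tw).
Qed.

Lemma folner_average_ge0 F phi y :
  (forall z, 0 <= phi z) -> 0 <= folner_average F phi y.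
Proof.
move=> phi0; rewrite mulr_ge0 ?invr_ge0//; apply: sumr_ge0 => c _.
rewrite divr_ge0 ?total_weight_ge0//; apply: sumr_ge0 => g _.
by rewrite mulr_ge0// (density_ge0 Tw).
Qed.

Lemma folner_average_le1 F phi y :
  (forall z, 0 <= phi z <= 1) -> folner_average F phi y <= 1.
Proof.
move=> phi01; have [->|F0] := eqVneq F fset0.
  by rewrite /folner_average cardfs0 invr0 mul0r.
rewrite /folner_average ler_pdivrMl ?ltr0n ?cardfs_gt0// mulr1.
apply: (@le_trans _ _ (\sum_(c <- F) 1)); last first.
  by rewrite big_const_seq count_predT iter_addr_0.
apply: ler_sum => c _; rewrite /ratio_average.
have := total_weight_ge0 F c y; rewrite le_eqVlt => /predU1P[<-|D0].
  by rewrite invr0 mulr0.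
rewrite ler_pdivrMr// mul1r; apply: ler_sum => g _.
by rewrite ler_piMr ?(density_ge0 Tw)//; have /andP[] := phi01 (T (g * c^-1)%g y).
Qed.

(** Rerooting: seen from the point in position [g] of the piece, the weights are
    rescaled by the weight of that point. *)
Lemma total_weight_reroot F c g y : regular_point T w y ->
  total_weight F c y =
    total_weight F g (T (g * c^-1)%g y) * w (g * c^-1)%g y.
Proof.
move=> [_ coc]; rewrite /total_weight mulr_suml; apply: eq_bigr => k _.
by rewrite -coc mulgA mulgVK.
Qed.

(** Move each term to the point that carries the value of [phi]: by rerooting, the
    terms with a given [g] then share the denominator [total_weight F g], and
    summing them over [c] reproduces this denominator as a numerator. *)
Theorem integral_folner_average F phi : F != fset0 ->
  measurable_fun [set: Y] phi -> (forall y, 0 <= phi y) ->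
  (\int[nu]_y (folner_average F phi y)%:E = \int[nu]_y (phi y)%:E)%E.
Proof.
move=> F0 mphi phi0; have reg := ae_regular Tw cG.
have D0 c y : 0 <= total_weight F c y by exact: total_weight_ge0.
have mw g : measurable_fun [set: Y] (w g) by exact: (measurable_density Tw).
have w0 g y : 0 <= w g y by exact: (density_ge0 Tw).
have mphiT g : measurable_fun [set: Y] (fun y => phi (T g y)).
  by apply: (measurableT_comp mphi); exact: (measurable_action Tw).
have mV c : measurable_fun [set: Y] (fun y => (total_weight F c y)^-1).
  exact: measurable_total_weightV.
pose term c g y := w (g * c^-1)%g y * phi (T (g * c^-1)%g y) / total_weight F c y.
pose term' c g y := phi y / total_weight F g y * w (c * g^-1)%g y.
have mterm c g : measurable_fun [set: Y] (EFin \o term c g).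
  by apply/measurable_EFinP; apply: measurable_funM => //; exact: measurable_funM.
have mterm' c g : measurable_fun [set: Y] (EFin \o term' c g).
  by apply/measurable_EFinP; apply: measurable_funM => //; exact: measurable_funM.
have term0 c g y : (0 <= (term c g y)%:E)%E by rewrite lee_fin divr_ge0// mulr_ge0.
have term0' c g y : (0 <= (term' c g y)%:E)%E.
  by rewrite lee_fin mulr_ge0// divr_ge0.
have moved c g : (\int[nu]_y (term c g y)%:E = \int[nu]_y (term' c g y)%:E)%E.
  pose f y := (phi y / total_weight F g y)%:E.
  have mf : measurable_fun [set: Y] f by apply/measurable_EFinP; exact: measurable_funM.
  transitivity (\int[nu]_y f (T (g * c^-1)%g y))%E.
    apply: ge0_ae_eq_integral => //.
    - exact: mterm.
    - exact: (measurable_comp_action Tw _ mf).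
    - by move=> y _; rewrite lee_fin divr_ge0.
    apply: filterS reg => y ry _; congr (_%:E).
    have [w_gt0 _] := ry; rewrite /term (total_weight_reroot F c g ry) invfM.
    by rewrite [w _ _ * _]mulrC mulrACA mulfV ?mulr1// gt_eqF.
  rewrite (integral_comp_action Tw)//; last by move=> y; rewrite lee_fin divr_ge0.
  by rewrite invgM invgK.
have avgE y : (folner_average F phi y)%:E =
    ((#|` F|%:R^-1)%:E * \sum_(c <- F) \sum_(g <- F) (term c g y)%:E)%E.
  rewrite EFinM -sumEFin; congr (_ * _)%E; apply: eq_bigr => c _.
  by rewrite sumEFin -mulr_suml.
under eq_integral do rewrite avgE.
rewrite ge0_integralZl//; last 2 first.
- by apply: emeasurable_sum => c; apply: emeasurable_sum => g; exact: mterm.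
- by move=> y _; apply: sume_ge0 => c _; apply: sume_ge0.
rewrite ge0_integral_sum//; last 2 first.
- by move=> c; apply: emeasurable_sum => g; exact: mterm.
- by move=> c y _; apply: sume_ge0.
have -> : (\sum_(c <- F) \int[nu]_y (\sum_(g <- F) (term c g y)%:E) =
           \sum_(g <- F) \sum_(c <- F) \int[nu]_y (term' c g y)%:E)%E.
  rewrite [RHS]exchange_big/=; apply: eq_bigr => c _.
  rewrite ge0_integral_sum//; last by move=> g; exact: mterm.
  by apply: eq_bigr => g _; exact: moved.
have colsum g : (\sum_(c <- F) \int[nu]_y (term' c g y)%:E = \int[nu]_y (phi y)%:E)%E.
  rewrite -ge0_integral_sum//; last by move=> c; exact: mterm'.
  apply: ge0_ae_eq_integral => //.
  - by apply: emeasurable_sum => c; exact: mterm'.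
  - exact/measurable_EFinP.
  - by move=> y _; apply: sume_ge0.
  - by move=> y _; rewrite lee_fin.
  apply: filterS reg => y ry _; rewrite sumEFin -mulr_sumr -/(total_weight F g y).
  by rewrite divfK// gt_eqF// total_weight_gt0.
under eq_bigr do rewrite colsum.
have cF0 : #|` F|%:R != 0 :> R by rewrite pnatr_eq0 cardfs_eq0.
by rewrite sume_const_seq muleA -EFinM mulVf// mul1e.
Qed.

Lemma folner_average_invariant F phi y : F != fset0 -> regular_point T w y ->
  (forall g, phi (T g y) = phi y) -> folner_average F phi y = phi y.
Proof.
move=> F0 ry inv; rewrite /folner_average (eq_bigr (fun=> phi y)) => [|c _].
  rewrite big_const_seq count_predT iter_addr_0 -(mulr_natl (phi y)) mulKf//.
  by rewrite pnatr_eq0 cardfs_eq0.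
rewrite /ratio_average; under eq_bigr do rewrite inv.
by rewrite -mulr_suml mulrC mulKf// gt_eqF// total_weight_gt0.
Qed.

Lemma folner_averageB F phi psi y :
  folner_average F phi y - folner_average F psi y =
  folner_average F (fun z => phi z - psi z) y.
Proof.
rewrite /folner_average -mulrBr -sumrB; congr (_ * _); apply: eq_bigr => c _.
rewrite /ratio_average -mulrBl -sumrB; congr (_ / _); apply: eq_bigr => g _.
by rewrite mulrBr.
Qed.

Lemma norm_folner_average F phi y :
  `|folner_average F phi y| <= folner_average F (fun z => `|phi z|) y.
Proof.
rewrite normrM ger0_norm ?invr_ge0// ler_wpM2l ?invr_ge0//.
apply: le_trans (ler_norm_sum _ _ _) _; apply: ler_sum => c _.
rewrite normrM (ger0_norm (x := _^-1)) ?invr_ge0 ?total_weight_ge0//.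
rewrite ler_wpM2r ?invr_ge0 ?total_weight_ge0//.
apply: le_trans (ler_norm_sum _ _ _) _; apply: ler_sum => g _.
by rewrite normrM ger0_norm ?(density_ge0 Tw).
Qed.

(** The operator contracts the L1 norm and fixes invariant functions, so it does
    not increase the distance to an invariant set. *)
Lemma folner_average_dist F phi psi : F != fset0 ->
  measurable_fun [set: Y] phi -> measurable_fun [set: Y] psi ->
  (forall g y, psi (T g y) = psi y) ->
  (\int[nu]_y (`|folner_average F phi y - psi y|)%:E <=
   \int[nu]_y (`|phi y - psi y|)%:E)%E.
Proof.
move=> F0 mphi mpsi inv.
have mabs : measurable_fun [set: Y] (fun z => `|phi z - psi z|).
  by apply: (measurableT_comp (@normr_measurable R setT)); exact: measurable_funB.
rewrite -(integral_folner_average F0 mabs)//.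
apply: ae_ge0_le_integral => //.
- apply/measurable_EFinP/(measurableT_comp (@normr_measurable R setT)).
  by apply: measurable_funB => //; exact: measurable_folner_average.
- by move=> y _; rewrite lee_fin folner_average_ge0.
- by apply/measurable_EFinP; exact: measurable_folner_average.
apply: filterS (ae_regular Tw cG) => y ry _.
rewrite lee_fin -[X in _ - X](folner_average_invariant (F := F)) ?folner_averageB//.
exact: norm_folner_average.
Qed.

(** The error term in the comparison below: two orbits that agree only off [K] may
    differ by the proportion of the weight that [K] carries. *)
Definition weight_share F (K : {fset G}) y := #|` F|%:R^-1 * \sum_(c <- F)
  (\sum_(g <- F | (g * c^-1)%g \in K) w (g * c^-1)%g y) / total_weight F c y.

(** The numerators and the denominators of the ratio averages each contribute a
    factor [a]. *)
Lemma folner_average_compare F (K : {fset G}) (a : R) (A : set Y) y z :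
  F != fset0 -> regular_point T w y -> regular_point T w z -> 0 < a ->
  (forall g, w g y <= a * w g z) -> (forall g, w g z <= a * w g y) ->
  (forall g, g \notin K -> A (T g y) <-> A (T g z)) ->
  folner_average F \1_A y <= a ^+ 2 * folner_average F \1_A z + weight_share F K y.
Proof.
move=> F0 ry rz a0 yz zy AK; rewrite /folner_average /weight_share.
rewrite mulrCA -mulrDr ler_wpM2l ?invr_ge0// mulr_sumr -big_split/=.
apply: ler_sum => c _; rewrite /ratio_average.
have Dy := total_weight_gt0 c F0 ry; have Dz := total_weight_gt0 c F0 rz.
have Dzy : total_weight F c z <= a * total_weight F c y.
  by rewrite /total_weight mulr_sumr; apply: ler_sum => g _.
set Sz := \sum_(g <- F) w (g * c^-1)%g z * _.
have Sz0 : 0 <= Sz.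
  by apply: sumr_ge0 => g _; rewrite mulr_ge0 ?(density_ge0 Tw).
have num : \sum_(g <- F) w (g * c^-1)%g y * \1_A (T (g * c^-1)%g y) <=
    a * Sz + \sum_(g <- F | (g * c^-1)%g \in K) w (g * c^-1)%g y.
  rewrite mulr_sumr [X in _ + X]big_mkcond -big_split/=; apply: ler_sum => g _.
  case: ifPn => [_|gK].
    apply: ler_wpDl.
      by rewrite !mulr_ge0 ?(density_ge0 Tw) ?(ltW a0).
    by rewrite ler_piMr ?(density_ge0 Tw)// indicE; case: (_ \in _).
  rewrite addr0 mulrA; have -> : \1_A (T (g * c^-1)%g y) = \1_A (T (g * c^-1)%g z) :> R.
    rewrite !indicE; congr ((_ : bool)%:R).
    by apply/idP/idP; rewrite !inE => /(AK _ gK).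
  by rewrite ler_wpM2r.
apply: le_trans (_ : _ <= (a * Sz + \sum_(g <- F | (g * c^-1)%g \in K) w (g * c^-1)%g y) /
    total_weight F c y) _; first by rewrite ler_pM2r ?invr_gt0.
rewrite mulrDl lerD2r ler_pdivrMr//.
set Q := Sz / _; rewrite (_ : _ * Q * _ = a * (Q * (a * total_weight F c y))); last by ring.
rewrite ler_pM2l// (_ : Sz = Q * total_weight F c z); last by rewrite divfK// gt_eqF.
by rewrite ler_wpM2l// divr_ge0// ltW.
Qed.

(** For most positions [c] the piece [F n * c^-1] contains a prescribed finite set
    [L], whose weight exceeds that of [K] by any factor at a recurrent point. The
    other positions form the boundary of [F n]. *)
Lemma weight_share_cvg0 (F : nat -> {fset G}) (K : {fset G}) y :
  folner_sequence R F -> regular_point T w y ->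
  (forall M : R, exists L : {fset G}, M <= \sum_(l <- L) w l y) ->
  forall e : R, 0 < e -> exists N, forall n, (N <= n)%N -> weight_share (F n) K y <= e.
Proof.
move=> [F0 folF] ry rec e e0; have [w_gt0 _] := ry.
set WK := \sum_(k <- K) w k y.
have WK0 : 0 <= WK by apply: sumr_ge0 => *; exact/ltW/w_gt0.
have [L hL] := rec (1 + WK / (e / 2)).
have e20 : 0 < e / 2 by rewrite divr_gt0.
have [N hN] := folF L _ e20; exists N => n /hN {}hN.
set D := total_weight (F n).
have D0 c : 0 < D c y by exact: total_weight_gt0 (F0 n) ry.
have share1 c : (\sum_(g <- F n | (g * c^-1)%g \in K) w (g * c^-1)%g y) / D c y <= 1.
  rewrite ler_pdivrMr// mul1r /D /total_weight [leRHS](bigID (fun g => (g * c^-1)%g \in K))/=.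
  by rewrite lerDl; apply: sumr_ge0 => *; exact/ltW/w_gt0.
have shareK c : c \notin inner_boundary L (F n) -> c \in F n ->
    (\sum_(g <- F n | (g * c^-1)%g \in K) w (g * c^-1)%g y) / D c y <= e / 2.
  move=> cB cF; have {cB} Lc l : l \in L -> (l * c)%g \in F n.
    by move: cB; rewrite !inE/= cF/= negbK => /allP; exact.
  have DL : 1 + WK / (e / 2) <= D c y.
    apply: le_trans hL _; rewrite /D /total_weight.
    rewrite (eq_bigr (fun l => w (l * c * c^-1)%g y)) => [|l _]; last by rewrite mulgK.
    apply: (@sum_fset_inj_le _ _ _ _ _ (fun l => (l * c)%g) (fun x => w (x * c^-1)%g y)).
    - exact: mulIg.
    - by move=> l; exact: Lc.
    - by move=> x; exact/ltW/w_gt0.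
  rewrite ler_pdivrMr//; apply: (@le_trans _ _ WK).
    rewrite big_fset_condE.
    apply: (@sum_fset_inj_le _ _ _ _ _ (fun g => (g * c^-1)%g) (fun k => w k y)).
    - exact: mulIg.
    - by move=> g; rewrite !inE/= => /andP[].
    - by move=> g; exact/ltW/w_gt0.
  rewrite -ler_pdivrMl// mulrC; apply: le_trans DL.
  by rewrite lerDr.
rewrite /weight_share ler_pdivrMl ?ltr0n ?cardfs_gt0 ?F0//.
apply: (@le_trans _ _ (\sum_(c <- F n) ((c \in inner_boundary L (F n))%:R + e / 2))).
  rewrite [leLHS]big_seq [leRHS]big_seq; apply: ler_sum => c cF; have [cB|cB] := boolP (c \in _).
    by rewrite (le_trans (share1 c))// lerDl ltW.
  by rewrite add0r; exact: shareK.
rewrite big_split/= big_const_seq count_predT iter_addr_0.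
rewrite [X in _ <= _ * X](splitr e) mulrDr -(mulr_natl (e / 2)) lerD2r mulrC.
apply: le_trans hN.
rewrite (eq_bigr (fun c => if c \in inner_boundary L (F n) then 1 else 0)); last first.
  by move=> c _; case: ifP.
rewrite -big_mkcond big_fset_condE big_const_seq count_predT iter_addr_0 ler_nat.
by apply/fsubset_leq_card/fsubsetP => c; rewrite !inE/= => /andP[_].
Qed.

End FolnerAverage.

(** * Convex combinations of tails *)

Section TailHull.
Context (R : realType) d (Y : measurableType d).
Variable nu : probability Y R.
Implicit Types (f g : Y -> R) (u : nat -> Y -> R).

(** Midpoints are the only convex combinations that the parallelogram identity
    calls for. *)
Inductive tail_hull u (k : nat) : (Y -> R) -> Prop :=
| tail_hull_term n : (k <= n)%N -> tail_hull u k (u n)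
| tail_hull_mid f g : tail_hull u k f -> tail_hull u k g ->
    tail_hull u k (fun y => (f y + g y) / 2).

Lemma tail_hull_le u k l f : (k <= l)%N -> tail_hull u l f -> tail_hull u k f.
Proof.
move=> kl; elim=> [n ln|f1 f2 _ h1 _ h2]; last exact: tail_hull_mid.
by apply: tail_hull_term; exact: leq_trans kl ln.
Qed.

Definition energy f := fine (\int[nu]_y (f y ^+ 2)%:E).

Definition unit_measurable f := measurable_fun [set: Y] f /\ forall y, 0 <= f y <= 1.

Lemma tail_hull_unit u k f :
  (forall n, unit_measurable (u n)) -> tail_hull u k f -> unit_measurable f.
Proof.
move=> hu; elim=> [n _|f1 f2 _ [mf1 h1] _ [mf2 h2]]; first exact: hu.
split; first by apply: measurable_funM => //; exact: measurable_funD.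
by move=> y; have := h1 y; have := h2 y; lra.
Qed.

Lemma measurable_sqr f : measurable_fun [set: Y] f ->
  measurable_fun [set: Y] (fun y => (f y ^+ 2)%:E).
Proof. by move=> mf; apply/measurable_EFinP; exact: measurable_funX. Qed.

Lemma energyE f : unit_measurable f ->
  ((energy f)%:E = \int[nu]_y (f y ^+ 2)%:E)%E /\ 0 <= energy f <= 1.
Proof.
move=> [mf f01].
have i0 : (0 <= \int[nu]_y (f y ^+ 2)%:E)%E.
  by apply: integral_ge0 => y _; rewrite lee_fin sqr_ge0.
have i1 : (\int[nu]_y (f y ^+ 2)%:E <= 1)%E.
  rewrite -(mul1e 1%E) -[X in (_ <= _ * X)%E](probability_setT nu).
  rewrite -(integral_cst nu measurableT 1%E); apply: ge0_le_integral => //.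
  - by move=> y _; rewrite lee_fin sqr_ge0.
  - exact: measurable_sqr.
  - by move=> y _; rewrite lee_fin expr_le1//; have /andP[] := f01 y.
have ifin : (\int[nu]_y (f y ^+ 2)%:E)%E \is a fin_num.
  by rewrite ge0_fin_numE// (le_lt_trans i1) ?ltry.
rewrite /energy fineK//; split=> //.
by rewrite -!lee_fin fineK// i0.
Qed.

Lemma parallelogram f g : unit_measurable f -> unit_measurable g ->
  (\int[nu]_y ((f y - g y) ^+ 2)%:E =
    (2 * energy f + 2 * energy g - 4 * energy (fun y => (f y + g y) / 2))%:E)%E.
Proof.
move=> hf hg; have [[mf f01] [mg g01]] := (hf, hg).
have hm : unit_measurable (fun y => (f y + g y) / 2).
  split; first by apply: measurable_funM => //; exact: measurable_funD.
  by move=> y; have := f01 y; have := g01 y; lra.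
have [ef _] := energyE hf; have [eg _] := energyE hg; have [em _] := energyE hm.
have md : measurable_fun [set: Y] (fun y => f y - g y) by exact: measurable_funB.
have [mm _] := hm.
have sq0 (h : Y -> R) y : setT y -> (0 <= (h y ^+ 2)%:E)%E by rewrite lee_fin sqr_ge0.
set I := (\int[nu]_y _)%E; set e := energy (fun y => (f y + g y) / 2).
suff sum : (I + (4 * e)%:E = (2 * energy f + 2 * energy g)%:E)%E.
  by rewrite EFinB -sum addeK.
rewrite EFinD !EFinM ef eg em /I -!ge0_integralZl//; try exact: measurable_sqr; try exact: sq0.
rewrite -!ge0_integralD//; try (by move=> y _; rewrite ?mule_ge0 ?lee_fin ?sqr_ge0);
  try (by apply: emeasurable_funM => //; exact: measurable_sqr); try exact: measurable_sqr.
apply: eq_integral => y _.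
by rewrite -!EFinM -!EFinD; congr (_%:E); field.
Qed.

(** By the arithmetic-geometric mean inequality [`|t| <= t ^+ 2 / (2 * s) + s / 2]. *)
Lemma L1_le_of_L2_le f (s : R) : measurable_fun [set: Y] f -> 0 < s ->
  (\int[nu]_y (f y ^+ 2)%:E <= (s ^+ 2)%:E)%E ->
  (\int[nu]_y (`|f y|)%:E <= s%:E)%E.
Proof.
move=> mf s0 fs.
have mf2 := measurable_sqr mf.
apply: (@le_trans _ _ (\int[nu]_y (((2 * s)^-1)%:E * (f y ^+ 2)%:E + (s / 2)%:E))%E).
  apply: ge0_le_integral => //.
  - by apply/measurable_EFinP/(measurableT_comp (@normr_measurable R setT)).
  - by apply: emeasurable_funD => //; exact: emeasurable_funM.
  - move=> y _; rewrite -EFinM -EFinD lee_fin -subr_ge0.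
    have -> : (2 * s)^-1 * f y ^+ 2 + s / 2 - `|f y| = (2 * s)^-1 * (`|f y| - s) ^+ 2.
      by rewrite -(real_normK (num_real (f y))); field; rewrite gt_eqF.
    by rewrite mulr_ge0 ?sqr_ge0// invr_ge0 mulr_ge0// ltW.
rewrite ge0_integralD//; last 3 first.
- by move=> y _; rewrite -EFinM lee_fin mulr_ge0 ?sqr_ge0 ?invr_ge0 ?mulr_ge0 ?ltW.
- exact: emeasurable_funM.
- by move=> y _; rewrite lee_fin divr_ge0 ?ltW.
rewrite ge0_integralZl//; last 2 first.
- by move=> y _; rewrite lee_fin sqr_ge0.
- by rewrite lee_fin invr_ge0 mulr_ge0 ?ltW.
rewrite integral_cst// [X in (_ + _ * X)%E]probability_setT mule1.
apply: (@le_trans _ _ (((2 * s)^-1)%:E * (s ^+ 2)%:E + (s / 2)%:E)%E).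
  by rewrite leeD2r// lee_wpmul2l// lee_fin invr_ge0 mulr_ge0 ?ltW.
by rewrite -EFinM -EFinD lee_fin le_eqVlt; apply/orP; left; apply/eqP; field; rewrite gt_eqF.
Qed.

(** Let [S] be the supremum over all tails of the infimum of the energy on the hull
    of the tail. Two elements of hulls of far tails with energy close to [S] are
    close in L2, because the energy of their midpoint cannot drop much below [S]. *)
Lemma tail_hull_cauchy u (delta : R) : (forall n, unit_measurable (u n)) -> 0 < delta ->
  exists f : nat -> Y -> R, (forall k, tail_hull u k (f k)) /\
    (\int[nu]_y (\sum_(k <oo) (`|f k.+1 y - f k y|)%:E) <= delta%:E)%E.
Proof.
move=> hu d0; pose En k := [set energy f | f in tail_hull u k].
pose J k := inf (En k).
have En01 k x : En k x -> 0 <= x <= 1.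
  by move=> [f hf <-]; have [_] := energyE (tail_hull_unit hu hf).
have En_inf k : has_inf (En k).
  split; last by exists 0 => x /En01/andP[].
  by exists (energy (u k)); exists (u k) => //; exact: tail_hull_term.
have J_le k f : tail_hull u k f -> J k <= energy f.
  by move=> hf; apply: ge_inf; [exact: (En_inf k).2|exists f].
have J_mono k l : (k <= l)%N -> J k <= J l.
  move=> kl; apply: lb_le_inf; first exact: (En_inf l).1.
  by move=> _ [f hf <-]; apply: J_le; exact: tail_hull_le kl hf.
pose S := sup (range J).
have J_sup : has_sup (range J).
  split; first by exists (J 0%N), 0%N.
  exists 1 => _ [k _ <-]; apply: le_trans (J_le k (u k) (tail_hull_term _ (leqnn k))) _.
  by have /andP[] := En01 k _ (ex_intro2 _ _ (u k) (tail_hull_term _ (leqnn k)) erefl).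
have J_S k : J k <= S by apply: sup_upper_bound => //; exists k.
have near_S k (eta : R) : 0 < eta -> exists lf : nat * (Y -> R),
    [/\ (k <= lf.1)%N, tail_hull u lf.1 lf.2, S - eta < J lf.1 & energy lf.2 < S + eta].
  move=> eta0; have [_ [l0 _ <-] hl0] := sup_adherent eta0 J_sup.
  pose l := maxn k l0; have [_ [f hf <-] fJ] := inf_adherent eta0 (En_inf l).
  exists (l, f); split=> //=; first exact: leq_maxl.
    by apply: lt_le_trans hl0 (J_mono _ _ _); exact: leq_maxr.
  by apply: lt_le_trans fJ _; rewrite lerD2r J_S.
pose s k : R := delta / (2 ^ k.+1)%:R.
have s0 k : 0 < s k by rewrite divr_gt0// ltr0n expn_gt0.
have sS k : s k.+1 <= s k.
  by rewrite /s ler_pM2l// lef_pV2 ?posrE ?ltr0n ?expn_gt0// ler_nat leq_exp2l.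
(* the parallelogram identity bounds the squared distance by [8 * eta k] *)
pose eta k := s k ^+ 2 / 8.
have eta0 k : 0 < eta k by rewrite /eta divr_gt0// exprn_gt0.
have /choice[lf lfP] k := near_S k (eta k) (eta0 k).
pose f k := (lf k).2; have hf k : unit_measurable (f k).
  by have [_ h _ _] := lfP k; exact: tail_hull_unit h.
exists f; split=> [k|].
  by have [kl h _ _] := lfP k; exact: tail_hull_le kl h.
have mdiff k : measurable_fun [set: Y] (fun y => f k.+1 y - f k y).
  by apply: measurable_funB; [have [] := hf k.+1|have [] := hf k].
have mabs k : measurable_fun [set: Y] (fun y => (`|f k.+1 y - f k y|)%:E).
  by apply/measurable_EFinP/(measurableT_comp (@normr_measurable R setT)).
rewrite integral_nneseries//.
apply: le_trans (epsilon_trick0 xpredT (ltW d0)).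
apply: lee_nneseries => [k _ _|k _]; first by apply: integral_ge0 => y _; rewrite lee_fin.
apply: (@L1_le_of_L2_le (fun y => f k.+1 y - f k y) (s k)) => //=.
rewrite (parallelogram (hf k.+1) (hf k)) lee_fin.
have [_ h1 J1 e1] := lfP k.+1; have [_ h0 J0 e0] := lfP k.
pose l := minn (lf k).1 (lf k.+1).1.
have hmid : tail_hull u l (fun y => (f k.+1 y + f k y) / 2).
  apply: tail_hull_mid; [apply: tail_hull_le h1|apply: tail_hull_le h0].
    exact: geq_minr.
  exact: geq_minl.
have eta_le : eta k.+1 <= eta k.
  by rewrite /eta ler_wpM2r// ler_pXn2r// nnegrE ltW.
have : S - eta k < J l.
  by rewrite /l /minn; case: ifP => _ //; apply: le_lt_trans J1; rewrite lerD2l lerN2.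
move: (J_le _ _ hmid) e1 e0 eta_le; rewrite -/(f k) -/(f k.+1).
have -> : s k ^+ 2 = 8 * eta k by rewrite /eta; field.
lra.
Qed.

End TailHull.

Lemma ereal_cvg0_small (R : realType) (u : nat -> \bar R) (e : R) :
  u n @[n --> \oo] --> 0%E -> 0 < e ->
  exists N, forall n, (N <= n)%N -> (u n <= e%:E)%E.
Proof.
move=> /fine_cvgP[[N1 _ ufin] /cvgrPdist_lt/(_ _)] /[apply] -[N2 _ ule].
exists (maxn N1 N2) => n; rewrite geq_max => /andP[N1n N2n].
rewrite -(fineK (ufin n N1n)) lee_fin; apply: le_trans (ler_norm _) _.
by apply: ltW; rewrite -normrN -sub0r; exact: ule.
Qed.

(** * Approximation in measure by an algebra of sets *)

Section Approximation.
Context (R : realType) d (Y : measurableType d).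
Variables (nu : probability Y R) (AA : set (set Y)).
Implicit Types A B : set Y.

Definition set_algebra :=
  [/\ AA set0, forall A, AA A -> AA (~` A) & forall A B, AA A -> AA B -> AA (A `|` B)].

Definition symdiff A B := (A `\` B) `|` (B `\` A).

Definition approximable B := measurable B /\
  forall e : R, 0 < e -> exists2 A, AA A & (nu (symdiff A B) <= e%:E)%E.

Hypothesis AA_algebra : set_algebra.
Hypothesis AA_measurable : AA `<=` measurable.

Lemma measurable_symdiff A B : measurable A -> measurable B -> measurable (symdiff A B).
Proof. by move=> mA mB; apply: measurableU; exact: measurableD. Qed.

Lemma measure_le_coverU2 A B C (a b : R) : measurable A -> measurable B -> measurable C ->
  A `<=` B `|` C -> (nu B <= a%:E)%E -> (nu C <= b%:E)%E -> (nu A <= (a + b)%:E)%E.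
Proof.
move=> mA mB mC ABC Ba Cb; apply: (@le_trans _ _ (nu (B `|` C))).
  by apply: le_measure; rewrite ?inE//; exact: measurableU.
by rewrite EFinD (le_trans (measureU2 _ mB mC))// leeD.
Qed.

Lemma approximable0 : approximable set0.
Proof.
have [AA0 _ _] := AA_algebra; split=> // e e0; exists set0 => //.
by rewrite /symdiff setDv setU0 measure0 lee_fin ltW.
Qed.

Lemma approximableC B : approximable B -> approximable (~` B).
Proof.
have [_ AAC _] := AA_algebra.
move=> [mB apB]; split; first exact: measurableC.
move=> e /apB[A AAA AB]; exists (~` A); first exact: AAC.
rewrite (_ : symdiff (~` A) (~` B) = symdiff A B)//.
by rewrite /symdiff !setDE !setCK setUC (setIC (~` B)) (setIC (~` A)).
Qed.

Lemma approximableU B C : approximable B -> approximable C -> approximable (B `|` C).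
Proof.
have [_ _ AAU] := AA_algebra.
move=> [mB apB] [mC apC]; split; first exact: measurableU.
move=> e e0; have e20 : 0 < e / 2 by rewrite divr_gt0.
have [A1 AA1 AB] := apB _ e20; have [A2 AA2 AC] := apC _ e20.
exists (A1 `|` A2); first exact: AAU.
have [mA1 mA2] := (AA_measurable AA1, AA_measurable AA2).
rewrite (splitr e); apply: measure_le_coverU2 AB AC; try by apply: measurable_symdiff => //;
  exact: measurableU.
by move=> y; rewrite /symdiff /setU /setD/=; tauto.
Qed.

Lemma approximable_bigcup (B : nat -> set Y) :
  (forall n, approximable (B n)) -> approximable (\bigcup_n B n).
Proof.
move=> apB; have mB n : measurable (B n) by have [] := apB n.
have mU : measurable (\bigcup_n B n) by exact: bigcupT_measurable.
pose V n := \big[setU/set0]_(i < n) B i.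
have apV n : approximable (V n).
  rewrite /V; elim: n => [|n IHn]; first by rewrite big_ord0; exact: approximable0.
  by rewrite big_ord_recr/=; exact: approximableU.
split=> // e e0; have e20 : 0 < e / 2 by rewrite divr_gt0.
pose D n := (\bigcup_n B n) `\` V n.
have mD n : measurable (D n) by apply: measurableD => //; have [] := apV n.
have D0 : \bigcap_n D n = set0.
  rewrite -subset0 => y Dy; have [[n _ By] _] := Dy 0%N Logic.I.
  by have [_] := Dy n.+1 Logic.I; apply; rewrite /V big_ord_recr/=; right.
have : nu (D n) @[n --> \oo] --> 0%E.
  rewrite -(measure0 nu) -D0; apply: nonincreasing_cvg_mu => //.
  - by apply: le_lt_trans (probability_le1 nu _) _; rewrite ?ltry.
  - by apply: bigcapT_measurable.
  - move=> m n mn; apply/subsetPset; apply: setDS; exact: subset_bigsetU.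
move=> /ereal_cvg0_small/(_ e20)[n /(_ _ (leqnn n)) Dn].
have [mV /(_ _ e20)[A AAA AV]] := apV n; exists A => //.
rewrite (splitr e); apply: measure_le_coverU2 AV Dn => //; try exact: measurable_symdiff;
  try by apply: measurable_symdiff => //; exact: AA_measurable.
move=> y; rewrite /symdiff /D /setU /setD/= => -[[Ay nBy]|[By nAy]].
  left; left; split=> // Vy; apply: nBy.
  by have := @bigsetU_bigcup _ B n y Vy.
by have [Vy|Vy] := pselect (V n y); [left; right|right].
Qed.

Lemma sigma_algebra_approximable : sigma_algebra setT approximable.
Proof.
split; first exact: approximable0.
- by move=> B apB; rewrite setTD; exact: approximableC.
- exact: approximable_bigcup.
Qed.

End Approximation.

(** * Invariant sets do not separate contracting pairs *)

Section ContractingPairs.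
Context (R : realType) d (Y : measurableType d) (G : groupType).
Variables (nu : probability Y R) (T : G -> Y -> Y) (w : G -> Y -> R).

Definition recurrent_point y :=
  forall M : R, exists L : {fset G}, M <= \sum_(l <- L) w l y.

Definition contracting_pair (AA : set (set Y)) y z :=
  (exists2 a : R, 0 < a & forall g, w g y <= a * w g z /\ w g z <= a * w g y) /\
  forall A, AA A -> exists K : {fset G}, forall g, g \notin K ->
    (A (T g y) <-> A (T g z)).

Lemma ae_small (M : nat -> Y -> \bar R) :
  (forall m, measurable_fun [set: Y] (M m)) -> (forall m y, (0 <= M m y)%E) ->
  (forall m, (\int[nu]_y M m y <= (1 / (2 ^ m.+1)%:R)%:E)%E) ->
  {ae nu, forall y, forall e : R, 0 < e ->
    exists N, forall m, (N <= m)%N -> (M m y <= e%:E)%E}.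
Proof.
move=> mM M0 Mle; pose S y := (\sum_(m <oo) M m y)%E.
have mS : measurable_fun [set: Y] S by exact: ge0_emeasurable_sum.
have S0 y : (0 <= S y)%E by exact: nneseries_ge0.
have Sint : nu.-integrable setT S.
  apply/integrableP; split=> //.
  under eq_integral do rewrite gee0_abs//.
  rewrite integral_nneseries//; apply: (@le_lt_trans _ _ 1%E); last exact: ltry.
  apply: le_trans (epsilon_trick0 xpredT ler01).
  by apply: lee_nneseries => [m _ _|m _ //]; exact: integral_ge0.
apply: filterS (integrable_ae measurableT Sint) => y /(_ Logic.I) Sfin e e0.
have Slt : (S y < +oo)%E by rewrite ltey_eq Sfin.
have [N SN] := ereal_cvg0_small (nneseries_tail_cvg Slt (fun k _ => M0 k y)) e0.
exists N => m /SN; apply: le_trans.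
apply: (@le_trans _ _ (\sum_(m <= k < m.+1) M k y)%E); first by rewrite big_nat1.
exact: nneseries_lim_ge.
Qed.

Hypotheses (Tw : action_with_density nu T w) (cG : countable [set: G]).

(** The averages of a set [A m] that approximates [B] are close to [\1_B] in L1, and
    so are their convex combinations. Convex combinations [f m k] of far tails
    converge fast enough for their distance to [\1_B] to be bounded, uniformly in
    [k], by a function [M m] of small integral. At both points of a contracting
    pair [f m k] takes comparable values when [k] is large, and [M m] is small when
    [m] is large. *)
Theorem invariant_set_contracting_pair (F : nat -> {fset G}) (AA : set (set Y)) (B : set Y) :
  folner_sequence R F -> AA `<=` measurable -> approximable nu AA B ->
  (forall g y, B (T g y) <-> B y) -> {ae nu, forall y, recurrent_point y} ->
  exists2 W, nu.-negligible (~` W) &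
    forall y z, W y -> W z -> contracting_pair AA y z -> B y -> B z.
Proof.
move=> folF mAA [mB apB] B_inv ae_rec; have [F0 _] := folF.
have Binv g y : \1_B (T g y) = \1_B y :> R.
  by rewrite !indicE; congr ((_ : bool)%:R); apply/idP/idP; rewrite !inE => /B_inv.
pose del m : R := 1 / (2 ^ m.+1)%:R / 2.
have del0 m : 0 < del m by rewrite !divr_gt0// ltr0n expn_gt0.
have /choice[A AP] m : exists A, AA A /\ (nu (symdiff A B) <= (del m)%:E)%E.
  by have [A] := apB _ (del0 m); exists A.
have mA m : measurable (A m) by apply: mAA; have [] := AP m.
pose u m n := folner_average T w (F n) (\1_(A m)).
have hu m n : unit_measurable (u m n).
  have ind01 y : 0 <= (\1_(A m) y : R) <= 1.
    by rewrite indicE; case: (_ \in _); rewrite ?lexx ?ler01.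
  split; first by apply: (measurable_folner_average Tw); exact: measurable_indic.
  move=> y; rewrite (folner_average_le1 Tw) ?andbT//.
  by apply: (folner_average_ge0 Tw) => z; have /andP[] := ind01 z.
have uB m n : (\int[nu]_y (`|u m n y - \1_B y|)%:E <= (del m)%:E)%E.
  have [_ ABm] := AP m; apply: le_trans ABm.
  apply: le_trans (folner_average_dist Tw cG (F0 n) _ _ Binv) _ => //.
  rewrite -(setIT (symdiff _ _)) -integral_indic//; last exact: measurable_symdiff.
  rewrite le_eqVlt; apply/orP; left; apply/eqP; apply: eq_integral => y _; congr (_%:E).
  rewrite !indicE; have [Ay|Ay] := pselect (A m y); have [By|By] := pselect (B y).
  - by rewrite (mem_set Ay) (mem_set By) memNset ?subrr ?normr0// => -[[]|[]].
  - by rewrite (mem_set Ay) (memNset By) mem_set ?subr0 ?normr1//; left.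
  - by rewrite (memNset Ay) (mem_set By) mem_set ?sub0r ?normrN ?normr1//; right.
  - by rewrite !memNset ?subrr ?normr0// => -[[]|[]].
have /choice[f fP] m := tail_hull_cauchy nu (hu m) (del0 m).
pose M m y := ((`|f m 0%N y - \1_B y|)%:E + \sum_(k <oo) (`|f m k.+1 y - f m k y|)%:E)%E.
have hf m k : unit_measurable (f m k).
  by have [/(_ k) h _] := fP m; exact: tail_hull_unit h.
have M0 m y : (0 <= M m y)%E.
  by rewrite adde_ge0 ?lee_fin//; apply: nneseries_ge0 => k _ _; rewrite lee_fin.
have mdist (g h : Y -> R) : measurable_fun [set: Y] g -> measurable_fun [set: Y] h ->
    measurable_fun [set: Y] (fun y => (`|g y - h y|)%:E).
  move=> mg mh; apply/measurable_EFinP/(measurableT_comp (@normr_measurable R setT)).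
  exact: measurable_funB.
have mind : measurable_fun [set: Y] (\1_B : Y -> R) by exact: measurable_indic.
have mf m k : measurable_fun [set: Y] (f m k) by have [] := hf m k.
have mser m : measurable_fun [set: Y] (fun y => \sum_(k <oo) (`|f m k.+1 y - f m k y|)%:E)%E.
  by apply: ge0_emeasurable_sum => k *; [rewrite lee_fin|exact: mdist].
have mM m : measurable_fun [set: Y] (M m).
  by apply: emeasurable_funD => //; exact: mdist.
have fB m k g : tail_hull (u m) k g -> (\int[nu]_y (`|g y - \1_B y|)%:E <= (del m)%:E)%E.
  elim=> [n _|g1 g2 hg1 I1 hg2 I2]; first exact: uB.
  have [mg1 _] := tail_hull_unit (hu m) hg1; have [mg2 _] := tail_hull_unit (hu m) hg2.
  have half0 : (0 <= (1 / 2 : R)%:E)%E by rewrite lee_fin divr_ge0.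
  apply: (@le_trans _ _ (\int[nu]_y ((1 / 2)%:E * (`|g1 y - \1_B y|)%:E +
                                     (1 / 2)%:E * (`|g2 y - \1_B y|)%:E))%E).
    apply: ge0_le_integral => //.
    - by apply: mdist => //; apply: measurable_funM => //; exact: measurable_funD.
    - by apply: emeasurable_funD; apply: emeasurable_funM => //; exact: mdist.
    - move=> y _; rewrite -!EFinM -EFinD lee_fin.
      rewrite (_ : _ / 2 - _ = 1 / 2 * (g1 y - \1_B y) + 1 / 2 * (g2 y - \1_B y)); last by field.
      apply: le_trans (ler_normD _ _) _.
      by rewrite !(normrM (1 / 2)) (@ger0_norm _ (1 / 2)) ?divr_ge0.
  rewrite ge0_integralD//; last 2 first.
  - by apply: emeasurable_funM => //; exact: mdist.
  - by apply: emeasurable_funM => //; exact: mdist.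
  rewrite !ge0_integralZl//; try exact: mdist; try by move=> y _; rewrite lee_fin.
  rewrite (_ : (del m)%:E = (1 / 2)%:E * (del m)%:E + (1 / 2)%:E * (del m)%:E)%E.
    by rewrite leeD// lee_wpmul2l.
  by rewrite -EFinM -EFinD; congr (_%:E); field.
have Mint m : (\int[nu]_y M m y <= (1 / (2 ^ m.+1)%:R)%:E)%E.
  have [/(_ 0%N) f0 ser] := fP m.
  rewrite ge0_integralD//; last 2 first.
  - exact: mdist.
  - by move=> y _; apply: nneseries_ge0 => k _ _; rewrite lee_fin.
  by rewrite [X in X%:E](splitr (1 / _)) EFinD leeD//; exact: fB f0.
have MfB m k y : ((`|f m k y - \1_B y|)%:E <= M m y)%E.
  apply: (@le_trans _ _ ((`|f m 0%N y - \1_B y|)%:E +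
      \sum_(0 <= j < k) (`|f m j.+1 y - f m j y|)%:E)%E); last first.
    by rewrite leeD2l//; apply: nneseries_lim_ge => j _ _; rewrite lee_fin.
  elim: k => [|k IHk]; first by rewrite big_nil adde0.
  rewrite big_nat_recr//= addeA; apply: le_trans (leeD2r _ IHk).
  by rewrite -EFinD lee_fin [leRHS]addrC ler_distD.
pose W := [set y | regular_point T w y /\ recurrent_point y /\
  forall e : R, 0 < e -> exists N, forall m, (N <= m)%N -> (M m y <= e%:E)%E].
exists W.
  apply: filterS3 (ae_regular Tw cG) ae_rec (ae_small mM M0 Mint) => y ry recy My.
  by rewrite /W.
move=> y z [ry [recy My]] [rz [_ Mz]] [[a a0 yza] sep] By; apply: contrapT => Bz.
(* small enough for [(a ^+ 2 + 2) * e < 1] *)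
pose e := (a ^+ 2 + 3)^-1.
have e0 : 0 < e by rewrite invr_gt0 addr_gt0// exprn_gt0.
have [N1 My1] := My e e0; have [N2 Mz2] := Mz e e0.
pose m := maxn N1 N2.
have Mye : (M m y <= e%:E)%E by apply: My1; exact: leq_maxl.
have Mze : (M m z <= e%:E)%E by apply: Mz2; exact: leq_maxr.
have [K AK] := sep (A m) (AP m).1.
have [N shareN] := weight_share_cvg0 K folF ry recy e0.
have ucmp n : (N <= n)%N -> u m n y <= a ^+ 2 * u m n z + e.
  move=> Nn; apply: le_trans (folner_average_compare Tw (F0 n) ry rz a0 _ _ AK) _.
  - by move=> g; have [] := yza g.
  - by move=> g; have [] := yza g.
  - by rewrite lerD2l shareN.
have fcmp : f m N y <= a ^+ 2 * f m N z + e.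
  have [/(_ N) h _] := fP m; elim: h => [n Nn|f1 f2 _ h1 _ h2]; first exact: ucmp.
  by lra.
have := le_trans (MfB m N y) Mye; have := le_trans (MfB m N z) Mze.
rewrite !lee_fin !indicE (mem_set By) (memNset Bz)/= subr0 => fz fy.
have fz' : f m N z <= e by apply: le_trans fz; exact: ler_norm.
have fy' : 1 - e <= f m N y.
  by rewrite lerBlDr addrC -lerBlDr; apply: le_trans fy; rewrite distrC; exact: ler_norm.
have : 1 <= (a ^+ 2 + 2) * e.
  have : a ^+ 2 * f m N z <= a ^+ 2 * e by rewrite ler_wpM2l// sqr_ge0.
  by move: fcmp fy'; lra.
by rewrite -ler_pdivrMr// mul1r invrK lerD2l ler_nat.
Qed.
End ContractingPairs.

(** * Conservative actions have infinite total weight *)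

Section Recurrence.
Context (R : realType) d (Y : measurableType d) (G : groupType).
Variables (nu : probability Y R) (T : G -> Y -> Y) (w : G -> Y -> R).

Lemma rn_derivative_density : borel_action T ->
  (forall g, is_rn_derivative nu (T g) (w g)) -> action_with_density nu T w.
Proof.
move=> Tact wrn; have [act1 actM mT] := Tact; split=> //.
- by move=> g; have [] := wrn g.
- by move=> g y; have [] := wrn g.
move=> g f mf f0; have [mw w0 wE] := wrn g.
apply: (@integral_density_pushforward _ _ _ _ _ nu nu) => // C mC.
have mTC : measurable (T g @^-1` C) by rewrite -(setTI (_ @^-1` _)); exact: mT.
rewrite -wE//; congr (nu _); apply/seteqP; split=> [_ [y Cy <-]//|y Cy].
by exists (T g^-1%g y); rewrite /= -actM mulgV act1.
Qed.

(** If the weights had a finite sum, at most [k], on a set [P] of positive measure,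
    the expected number of visits to [P] would be at most [k] as well, so almost
    every orbit would visit [P] finitely often. *)
Lemma conservative_recurrent : countable [set: G] -> infinite_set [set: G] ->
  action_with_density nu T w -> conservative nu T ->
  {ae nu, forall y, recurrent_point w y}.
Proof.
move=> cG iG Tw cons.
have [enum [enum_inj enum_surj]] : exists enum : nat -> G,
    injective enum /\ forall g, exists i, enum i = g.
  have /card_set_bijP[f [_ f_inj f_surj]] := eq_card_nat cG iG.
  have /choice[e eP] i : exists g, f g = i by have [g _ <-] := f_surj i Logic.I; exists g.
  exists e; split=> [i j eij|g]; first by rewrite -(eP i) eij eP.
  by exists (f g); apply: f_inj; rewrite ?inE.
have mw g : measurable_fun [set: Y] (w g) by exact: (measurable_density Tw).
have w0 g y : 0 <= w g y by exact: (density_ge0 Tw).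
pose P k := [set y | forall n, \sum_(i < n) w (enum i) y <= k%:R].
have mP k : measurable (P k).
  have -> : P k = \bigcap_n [set y | \sum_(i < n) w (enum i) y <= k%:R].
    by apply/seteqP; split=> [y Py n _|y Py n]; exact: Py.
  apply: bigcapT_measurable => n.
  rewrite -[X in measurable X]setTI; apply: measurable_fun_le => //.
  exact: measurable_sum.
have aeP k : {ae nu, forall y, ~ P k y}.
  have [P0|P0] := eqVneq (nu (P k)) 0%E.
    by exists (P k); split=> // y /= /contrapT.
  pose h i y : \bar R := (\1_(P k) (T (enum i)^-1%g y))%:E.
  have mh i : measurable_fun [set: Y] (h i).
    apply/measurable_EFinP/measurableT_comp; first exact: measurable_indic.
    exact: (measurable_action Tw).
  have h0 i y : (0 <= h i y)%E by rewrite lee_fin.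
  have mS : measurable_fun [set: Y] (fun y => \sum_(i <oo) h i y)%E.
    exact: ge0_emeasurable_sum.
  have mh' i : measurable_fun [set: Y] (fun y => (\1_(P k) y)%:E * (w (enum i) y)%:E)%E.
    by apply: emeasurable_funM; apply/measurable_EFinP => //; exact: measurable_indic.
  have Sint : nu.-integrable setT (fun y => \sum_(i <oo) h i y)%E.
    apply/integrableP; split=> //.
    under eq_integral do rewrite gee0_abs ?nneseries_ge0//.
    rewrite integral_nneseries//.
    rewrite (eq_eseriesr (g := fun i =>
      \int[nu]_y ((\1_(P k) y)%:E * (w (enum i) y)%:E))%E); last first.
      move=> i _; rewrite /h (integral_comp_action Tw _ (f := EFin \o \1_(P k)))//.
      - by rewrite invgK.
      - by apply/measurable_EFinP; exact: measurable_indic.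
      - by move=> y; rewrite lee_fin.
    rewrite -integral_nneseries//; last by move=> i y _; rewrite mule_ge0 ?lee_fin.
    apply: (@le_lt_trans _ _ (\int[nu]_y (cst k%:R%:E) y)%E); last first.
      by rewrite integral_cst// [X in (_ * X)%E]probability_setT mule1 ltry.
    apply: ge0_le_integral => //.
    - by move=> y _; apply: nneseries_ge0 => i _ _; rewrite mule_ge0 ?lee_fin.
    - by apply: ge0_emeasurable_sum => // i y _ _; rewrite mule_ge0 ?lee_fin.
    move=> y _; apply: lime_le.
      by apply: is_cvg_nneseries => i _ _; rewrite mule_ge0 ?lee_fin.
    apply: nearW => n; rewrite indicE; case: (boolP (y \in P k)) => [|_]; last first.
      by rewrite big1 ?lee_fin// => i _; rewrite mul0e.
    rewrite inE => /(_ n) Pn.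
    under eq_bigr do rewrite mul1e.
    by rewrite sumEFin lee_fin big_mkord.
  have /cons /= consP : (0 < nu (P k))%E by rewrite lt0e P0/=.
  have := integrable_ae measurableT Sint.
  apply: filterS2 (consP (mP k)) => y Pinf /(_ Logic.I) Sfin Py.
  apply: (Pinf Py).
  have Slt : (\sum_(i <oo) h i y < +oo)%E by rewrite ltey_eq Sfin.
  have half0 : 0 < 1 / 2 :> R by rewrite divr_gt0.
  have [N hN] := ereal_cvg0_small (nneseries_tail_cvg Slt (fun i _ => h0 i y)) half0.
  apply: (@sub_finite_set _ _ ((fun i => (enum i)^-1%g) @` `I_N)); last first.
    exact: finite_image.
  move=> g /= Pg; have [i gi] := enum_surj g^-1%g.
  exists i; last by rewrite gi invgK.
  rewrite /= ltnNge; apply/negP => /hN.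
  apply/negP; rewrite -ltNge; apply: (@lt_le_trans _ _ (h i y)).
    by rewrite /h gi invgK indicE mem_set// lte_fin ltr_pdivrMr// mul1r ltr1n.
  apply: (@le_trans _ _ (\sum_(i <= j < i.+1) h j y)%E); first by rewrite big_nat1.
  exact: nneseries_lim_ge.
have := ae_foralln aeP; apply: filterS => y nP M.
have [k Mk] : exists k : nat, M <= k%:R.
  by exists (Num.bound `|M|); apply: le_trans (ler_norm M) _; rewrite ltW// archi_boundP.
have /existsNP[n /negP] := nP k; rewrite -ltNge => kn.
exists [fset enum i | i in iota 0 n]%fset.
rewrite big_imfset/=; last by move=> i j _ _; exact: enum_inj.
apply: le_trans Mk (le_trans (ltW kn) _).
rewrite -(big_mkord xpredT (fun i => w (enum i) y)) /index_iota subn0.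
by rewrite undup_id ?iota_uniq.
Qed.

End Recurrence.

(** * Product actions *)

Section Products.
Context (R : realType) (G : groupType) d d' (X : measurableType d) (Z : measurableType d').
Variables (mu : probability X R) (rho : probability Z R).

Lemma measure_preserving_density (S : G -> Z -> Z) :
  measure_preserving rho S -> action_with_density rho S (fun _ _ => 1).
Proof.
move=> [Sact Srho]; apply: rn_derivative_density => // g; split=> // A mA.
by rewrite Srho// integral_cst// mul1e.
Qed.

Lemma product_action_density (Q : G -> X -> X) (w : G -> X -> R) (S : G -> Z -> Z) :
  action_with_density mu Q w -> measure_preserving rho S ->
  action_with_density (mu \x rho)%E (product_action Q S) (fun g p => w g p.1).
Proof.
move=> Qw /measure_preserving_density Srho.
have [[Qact1 QactM mQ] mw w0 Qcv] := Qw; have [[Sact1 SactM mS] _ _ Scv] := Srho.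
split=> //.
- split=> [[x z]|g h [x z]|g].
  + by rewrite /product_action /= Qact1 Sact1.
  + by rewrite /product_action /= QactM SactM.
  + apply/measurable_fun_pairP; split.
      by apply: (measurableT_comp (mQ g)); exact: measurable_fst.
    by apply: (measurableT_comp (mS g)); exact: measurable_snd.
- by move=> g; apply: (measurableT_comp (mw g)); exact: measurable_fst.
move=> g f mf f0.
have mT : measurable_fun [set: X * Z] (product_action Q S g).
  apply/measurable_fun_pairP; split.
    by apply: (measurableT_comp (mQ g)); exact: measurable_fst.
  by apply: (measurableT_comp (mS g)); exact: measurable_snd.
pose H x := (\int[rho]_z f (x, z))%E.
have mfx x : measurable_fun [set: Z] (fun z => f (x, z)).
  by apply: (measurableT_comp mf); exact: pair1_measurable.
have mH : measurable_fun [set: X] H by exact: measurable_fun_fubini_tonelli_F.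
have H0 x : (0 <= H x)%E by exact: integral_ge0.
rewrite fubini_tonelli1; last 2 first.
- apply: emeasurable_funM; first exact: (measurableT_comp mf).
  by apply/measurable_EFinP; apply: (measurableT_comp (mw g)); exact: measurable_fst.
- by move=> p; rewrite mule_ge0 ?lee_fin.
rewrite fubini_tonelli1// -[RHS](Qcv g _ mH)//; apply: eq_integral => x _.
rewrite /fubini_F /= ge0_integralZr//; last 2 first.
- exact: (measurableT_comp (mfx (Q g x)) (mS g)).
- by rewrite lee_fin.
congr (_ * _)%E; rewrite /H -(Scv g _ (mfx (Q g x)))//.
by apply: eq_integral => z _; rewrite mule1.
Qed.

Lemma null_prod_ysection (B : set (X * Z)) : measurable B ->
  (mu \x rho)%E B = 0%E <-> {ae rho, forall z, mu (ysection B z) = 0%E}.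
Proof.
move=> mB.
have mG : measurable_fun [set: Z] (mu \o ysection B) by exact: measurable_fun_ysection.
have -> : (mu \x rho)%E B = (\int[rho]_z `|(mu \o ysection B) z|)%E.
  rewrite (@product_measure_unique _ _ _ _ _ mu rho (mu \x^ rho)%E)//.
    by apply: eq_integral => z _; rewrite gee0_abs.
  by move=> A C mA mC; exact: product_measure2E.
split=> [/(ae_eq_integral_abs _ measurableT mG)|Bz].
  by apply: filterS => z /(_ Logic.I).
apply/(ae_eq_integral_abs _ measurableT mG).
by apply: filterS Bz => z Bz _.
Qed.

Lemma ae_fst (P : X -> Prop) :
  {ae mu, forall x, P x} -> {ae (mu \x rho)%E, forall p, P p.1}.
Proof.
move=> [N [mN N0 PN]]; exists (N `*` setT); split.
- exact: measurableX.
- by rewrite [LHS](product_measure1E mu rho mN measurableT) [X in (X * _)%E]N0 mul0e.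
- by move=> [x z] /= nP; split=> //; exact: PN.
Qed.

Lemma negligible_ysection (W : set (X * Z)) : (mu \x rho)%E.-negligible W ->
  {ae rho, forall z, mu.-negligible [set x | W (x, z)]}.
Proof.
move=> [N [mN N0 WN]]; apply: filterS ((null_prod_ysection mN).1 N0) => z Nz.
exists (ysection N z); split=> //; first exact: measurable_ysection.
by move=> x /= /WN Nxz; rewrite ysectionE; exact: Nxz.
Qed.

End Products.

(** * Uniformly clopen sets in an ultrametric space *)

Section UniformlyClopen.
Context (R : realType) (X : ptopologicalType) (dist : X -> X -> R).
Context d (Z : measurableType d).

(** The sets that cannot distinguish the orbits of two points whose distance along
    the action tends to zero. *)
Definition uniformly_clopen : set (set (borel X * Z)) :=
  [set D : set (borel X * Z) | measurable D /\
  exists2 e : R, 0 < e & forall x x' z, dist x x' < e -> D (x, z) <-> D (x', z)].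

Lemma uniformly_clopen_algebra : set_algebra uniformly_clopen.
Proof.
split.
- by split; [exact: measurable0|exists 1].
- move=> A [mA [e e0 Ae]]; split; first exact: measurableC.
  by exists e => // x x' z /Ae xx'; split=> nA /xx'.
- move=> A B [mA [e e0 Ae]] [mB [e' e'0 Be]]; split; first exact: measurableU.
  exists (Num.min e e'); first by rewrite lt_min e0.
  move=> x x' z; rewrite lt_min => /andP[/Ae xx' /Be yy'].
  by split=> -[/xx'|/yy'] h; [left|right|left|right].
Qed.

(** The ultrametric inequality makes the set of centers of [e]-balls contained in
    [U] a union of [e]-balls, and an open set is the union of these as [e] varies. *)
Lemma uniformly_clopen_approximable (mu : probability (borel X * Z)%type R) :
  is_ultrametric dist -> compatible_metric dist ->
  measurable `<=` approximable mu uniformly_clopen.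
Proof.
move=> [[d0 dE dC dD] ultra] nbE.
have sub : uniformly_clopen `<=` measurable by move=> D [].
have [sa0 saC saU] := sigma_algebra_approximable mu uniformly_clopen_algebra sub.
have saC' D : approximable mu uniformly_clopen D -> approximable mu uniformly_clopen (~` D).
  by move=> /saC; rewrite setTD.
have apI D : uniformly_clopen D -> approximable mu uniformly_clopen D.
  move=> DU; split; first exact: sub.
  by move=> e e0; exists D => //; rewrite /symdiff setDv setU0 measure0 lee_fin ltW.
have apX (A : set (borel X)) : measurable A ->
    approximable mu uniformly_clopen (A `*` setT).
  pose AX := [set A : set X | approximable mu uniformly_clopen (A `*` setT)].
  suff : <<s @open X >> `<=` AX by exact.
  apply: smallest_sub.
    split.
    - by rewrite /AX/= set0X.
    - move=> C /= /saC'; rewrite setTD.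
      by rewrite (_ : ~` (C `*` setT) = (~` C) `*` [set: Z])// predeqE => -[x z]/=; tauto.
    - by move=> C apC; rewrite /AX/= setX_bigcupl; exact: saU.
  move=> U oU.
  pose V n := [set x : X | forall y, dist x y < n.+1%:R^-1 -> U y].
  have r0 (n : nat) : 0 < n.+1%:R^-1 :> R by rewrite invr_gt0.
  have VE n x x' : dist x x' < n.+1%:R^-1 -> V n x -> V n x'.
    move=> xx' Vx y x'y; apply: Vx; apply: le_lt_trans (ultra x x' y) _.
    by rewrite gt_max xx'.
  have UV : U = \bigcup_n V n.
    apply/seteqP; split=> [x Ux|x [n _ Vx]]; last by apply: Vx; rewrite (dE x x).2.
    have : nbhs x U by apply: open_nbhs_nbhs.
    rewrite nbE => -[e /= e0 eU]; have [n ne] := ltr_add_invr e0.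
    exists n => // y xy; apply: eU => /=.
    by apply: lt_trans xy _; rewrite -[ltLHS]add0r.
  rewrite /AX/= UV setX_bigcupl; apply: saU => n; apply: apI; split.
    apply: measurableX => //; apply: sub_sigma_algebra.
    rewrite openE => x Vx; rewrite /interior/= nbE; exists n.+1%:R^-1 => //= y xy.
    exact: VE xy Vx.
  exists n.+1%:R^-1 => // x x' z xx'; split=> -[/= Vx _]; split=> //=.
    exact: VE xx' Vx.
  by apply: VE Vx; rewrite dC.
move=> D mD; suff : <<s [set A `*` B | A in measurable & B in measurable] >> `<=`
    approximable mu uniformly_clopen.
  by apply; rewrite -measurable_prod_measurableType.
apply: smallest_sub => [|_ [A mA [C mC <-]]]; first by split.
rewrite (_ : A `*` C = ~` (~` (A `*` setT) `|` ~` ([set: borel X] `*` C))); last first.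
  by rewrite setCU !setCK -setXI setIT setTI.
have apA := saC' _ (apX _ mA).
have apC : approximable mu uniformly_clopen (~` ([set: borel X] `*` C)).
  apply: saC'; apply: apI; split; first exact: measurableX.
  by exists 1 => // x x' z _; split=> -[].
exact/saC'/(approximableU uniformly_clopen_algebra sub apA apC).
Qed.

End UniformlyClopen.

(** * Ergodicity and weak mixing *)

Section InvariantSets.
Context (R : realType) (G : groupType) (X : ptopologicalType).
Variables (dist : X -> X -> R) (Rel : set (borel X * borel X))
  (mu : probability (borel X) R) (Q : G -> borel X -> borel X).

Lemma ae_exists d (Y : measurableType d) (nu : probability Y R) (P : Y -> Prop) :
  {ae nu, forall y, P y} -> exists y, P y.
Proof.
move=> [N [mN N0 PN]]; apply: contrapT => /forallNP nP.
have NT : N = setT by apply/seteqP; split=> // y _; exact/PN/nP.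
by move/eqP: N0; rewrite NT [X in X == _]probability_setT onee_eq0.
Qed.

(** The saturation of a null set need not be null, so the exceptional set cannot
    simply be discarded with its saturation; instead the two remaining pieces of
    [D] and of its complement are separated by a saturated set. *)
Lemma saturated_mod_null (D V : set (borel X)) :
  polish R X -> countable_borel_equivalence Rel -> measurable D ->
  mu.-negligible (~` V) ->
  (forall x y, V x -> V y -> Rel (x, y) -> D x -> D y) ->
  exists2 C, saturated_sets Rel C & mu (symdiff C D) = 0%E.
Proof.
move=> pX RelE mD [N [mN N0 VN]] Dinv.
have NV x : ~ N x -> V x by move=> nN; apply: contrapT => /VN.
have [||x y [Dx Nx] [Dy Ny] Exy|C [satC DC CD]] :=
    @saturated_separation R X Rel (D `\` N) (~` D `\` N) pX RelE.
- exact: measurableD.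
- by apply: measurableD => //; exact: measurableC.
- by apply: Dy; apply: Dinv Exy Dx; exact: NV.
exists C => //; have [mC _] := satC; apply: (subset_measure0 _ mN _ N0).
  exact: measurable_symdiff.
move=> x [[Cx nDx]|[Dx nCx]]; apply: contrapT => Nx.
  by have : (C `&` (~` D `\` N)) x; [|rewrite CD].
by apply: nCx; exact: DC.
Qed.

Variables (rn : G -> borel X -> R) (X0 : set (borel X))
  (alpha : borel X * borel X -> R).
Hypotheses (G_countable : countable [set: G]) (G_infinite : infinite_set [set: G])
  (G_amenable : amenable R G) (X_polish : polish_ultrametric dist)
  (Rel_cber : countable_borel_equivalence Rel)
  (Q_nonsingular : nonsingular mu Q) (Q_conservative : conservative mu Q)
  (rn_version : forall g, is_rn_derivative mu (Q g) (rn g))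
  (X0_conull : mu.-negligible (~` X0))
  (Q_contracts : forall x y, (Rel `&` X0 `*` X0) (x, y) ->
    forall e : R, 0 < e -> exists2 F : set G, finite_set F &
      forall g, ~ F g -> dist (Q g x) (Q g y) < e)
  (alpha_ge1 : forall p, Rel p -> 1 <= alpha p)
  (alpha_bound : forall x y, (Rel `&` X0 `*` X0) (x, y) -> forall g,
    (alpha (x, y))^-1 < rn g x / rn g y /\ rn g x / rn g y < alpha (x, y)).

Lemma related_weights x y : (Rel `&` X0 `*` X0) (x, y) ->
  exists2 a : R, 0 < a & forall g, rn g x <= a * rn g y /\ rn g y <= a * rn g x.
Proof.
move=> xy; have [Exy [/= Xx Xy]] := xy; have [_ Er _ _ _] := Rel_cber.
have a0 : 0 < alpha (x, y) by apply: lt_le_trans (alpha_ge1 Exy).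
exists (alpha (x, y)) => // g; have [lo hi] := alpha_bound xy g.
have ry : 0 < rn g y.
  have [_ /(_ y) + _] := rn_version g; rewrite le_eqVlt => /predU1P[y0|//].
  by move: lo; rewrite -y0 invr0 mulr0 invr_lt0 ltNge (ltW a0).
split; first by rewrite ltW// -ltr_pdivrMr.
move: lo; rewrite ltr_pdivlMr// mulrC -ltr_pdivlMr ?invr_gt0// invrK => lo.
by rewrite mulrC ltW.
Qed.

(** Points with the same second coordinate keep equal second coordinates along the
    action, so related points of [X] give contracting pairs in each fiber. *)
Lemma invariant_set_fiberwise d (Z : measurableType d) (rho : probability Z R)
    (S : G -> Z -> Z) (B : set (borel X * Z)) :
  measure_preserving rho S -> measurable B ->
  (forall g, product_action Q S g @` B = B) ->
  exists2 W, (mu \x rho)%E.-negligible (~` W) &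
    forall x y z, W (x, z) -> W (y, z) -> Rel (x, y) -> B (x, z) -> B (y, z).
Proof.
move=> Srho mB Binv; have [Qact _] := Q_nonsingular; have [_ ultraX nbX] := X_polish.
have Qw := rn_derivative_density Qact rn_version.
have QSw := product_action_density Qw Srho.
have [F folF] := amenable_folner_sequence G_countable G_amenable.
have rec := ae_fst rho (conservative_recurrent G_countable G_infinite Qw Q_conservative).
have QSact : borel_action (product_action Q S) by have [] := QSw.
have [W WN Wpair] := @invariant_set_contracting_pair _ _ _ _ (mu \x rho)%E _ _ QSw
  G_countable F (uniformly_clopen dist (Z := Z)) B folF (fun D => @proj1 _ _)
  (uniformly_clopen_approximable _ ultraX nbX mB) (invariant_setP QSact Binv) rec.
exists (W `&` [set p | X0 p.1]).
  by rewrite setCI; apply: negligibleU WN (ae_fst rho (P := X0) X0_conull).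
move=> x y z [Wx /= Xx] [Wy /= Xy] Exy; apply: Wpair => //.
have xy : (Rel `&` X0 `*` X0) (x, y) by [].
split; first by have [a a0 ha] := related_weights xy; exists a.
move=> A [mA [e e0 Ae]]; have [K finK Kd] := Q_contracts xy e0.
exists (fset_set K) => g; rewrite in_fset_set// => /negP gK; apply: Ae; apply: Kd.
by move/mem_set.
Qed.

Lemma null_or_conull_symdiff (C D : set (borel X)) : measurable C -> measurable D ->
  mu (symdiff C D) = 0%E -> null_or_conull mu C -> null_or_conull mu D.
Proof.
move=> mC mD CD0 C01.
have null_sub (A : set (borel X)) (E : set (borel X)) : measurable A -> measurable E ->
    mu E = 0%E -> A `<=` E `|` symdiff C D -> mu A = 0%E.
  move=> mA mE E0 AE; have mCD := measurable_symdiff mC mD.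
  by apply: (subset_measure0 mA _ AE); [exact: measurableU|exact: null_set_setU].
case: C01 => [C0|C0]; [left|right].
  apply: null_sub C0 _ => // x Dx.
  by have [Cx|Cx] := pselect (C x); [left|right; right].
apply: null_sub C0 _ => //; try exact: measurableC.
by move=> x nDx; have [Cx|Cx] := pselect (C x); [right; left|left].
Qed.

(** The identity action on a second copy of [X] turns [B] into a fiber of the
    invariant set [B `*` setT] of a product action. *)
Lemma ergodic_of_inv_ergodic : inv_ergodic mu Q Rel -> ergodic mu Q.
Proof.
move=> erg B mB Binv; have [Qact Qns] := Q_nonsingular; have [pX _ _] := X_polish.
pose S (g : G) (z : borel X) := z.
have Smu : measure_preserving mu S.
  by split=> [|g A mA]; [split=> // g; exact: measurable_id|rewrite image_id].
have BZinv g : product_action Q S g @` (B `*` setT) = B `*` setT.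
  apply/seteqP; split=> [_ [[x z] [/= Bx _] <-]|[x z] [/= Bx _]].
    by split=> //=; rewrite -(Binv g); exists x.
  by move: Bx; rewrite -{1}(Binv g) => -[x' Bx' <-]; exists (x', z).
have mBZ : measurable (B `*` [set: borel X]) by exact: measurableX.
have [W WN Winv] := invariant_set_fiberwise Smu mBZ BZinv.
have [z Wz] := ae_exists (negligible_ysection WN).
have [C satC CB] : exists2 C, saturated_sets Rel C & mu (symdiff C B) = 0%E.
  apply: (@saturated_mod_null B [set x | W (x, z)]) => // x y Wx Wy Exy Bx.
  by have [] := Winv x y z Wx Wy Exy (conj Bx Logic.I).
have [mC _] := satC; apply: (null_or_conull_symdiff mC mB CB).
apply: (erg _ satC) => g; rewrite -/(symdiff (Q g @` C) C).
have mCB := measurable_symdiff mC mB.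
have QCB0 : mu (Q g @` symdiff C B) = 0%E by exact: ((Qns g _ mCB).2 CB).
have mQ A : measurable A -> measurable (Q g @` A) by exact: measurable_image_action.
apply: (subset_measure0 (B := Q g @` symdiff C B `|` symdiff C B)).
- by apply: measurable_symdiff => //; exact: mQ.
- by apply: measurableU => //; exact: mQ.
- move=> x; rewrite !(image_action Qact)/=.
  have := invariant_setP Qact Binv g^-1%g x.
  rewrite /symdiff /setU /setD/=.
  by case: (pselect (C x)); case: (pselect (C (Q g^-1%g x))); case: (pselect (B x)); tauto.
- by apply: null_set_setU => //; exact: mQ.
Qed.

(** Each fiber of an invariant set is null or conull. Which of the two it is
    depends on an [S]-invariant set of [z], exactly invariant because every [Q g]
    preserves null sets. *)
Lemma weakly_mixing_of_inv_trivial : inv_trivial mu Rel -> weakly_mixing mu Q.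
Proof.
move=> triv d Z rho S _ Srho Serg D mD Dinv.
have [Qact Qns] := Q_nonsingular; have [pX _ _] := X_polish; have [Sact _] := Srho.
have QSact : borel_action (product_action Q S).
  by have [] := product_action_density (rn_derivative_density Qact rn_version) Srho.
have [W WN Winv] := invariant_set_fiberwise Srho mD Dinv.
have mDC : measurable (~` D) by exact: measurableC.
have sectionC z : ysection (~` D) z = ~` ysection D z.
  by apply/seteqP; split=> x; rewrite /= !ysectionE.
have fiber01 : {ae rho, forall z, null_or_conull mu (ysection D z)}.
  apply: filterS (negligible_ysection WN) => z Wz.
  have [C satC CD] : exists2 C, saturated_sets Rel C & mu (symdiff C (ysection D z)) = 0%E.
    apply: (@saturated_mod_null _ [set x | W (x, z)]) => //.
      exact: measurable_ysection.
    by move=> x y Wx Wy Exy; rewrite !ysectionE; exact: Winv.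
  have [mC _] := satC; apply: null_or_conull_symdiff CD (triv _ satC) => //.
  exact: measurable_ysection.
pose C := [set z | mu (ysection (~` D) z) = 0%E].
have mC : measurable C.
  have -> : C = [set: Z] `&` (mu \o ysection (~` D)) @^-1` [set 0%E].
    by rewrite setTI.
  by apply: measurable_fun_ysection => //; exact: emeasurable_set1.
have C_inv g z : C (S g z) <-> C z.
  rewrite /C /= -(Qns g (ysection (~` D) z)); last exact: measurable_ysection.
  suff -> : ysection (~` D) (S g z) = Q g @` ysection (~` D) z by [].
  rewrite (image_action Qact); apply/seteqP; split=> x; rewrite /= !ysectionE /=;
    have [_ gVK] := borel_actionK Qact g;
    have := invariant_setP QSact Dinv g (Q g^-1%g x, z);
    by rewrite /product_action/= gVK; tauto.
have CS g : S g @` C = C.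
  rewrite (image_action Sact); apply/seteqP.
  by split=> z /=; rewrite C_inv.
have [C0|C0] := Serg C mC CS.
  left; apply/(null_prod_ysection mu rho mD).
  have aeC : {ae rho, forall z, ~ C z}.
    by exists C; split=> // z /= /contrapT.
  apply: filterS2 fiber01 aeC => z [//|D0] nC; exfalso; apply: nC.
  by rewrite /C/= sectionC.
right; apply/(null_prod_ysection mu rho mDC).
by exists (~` C); split=> //; exact: measurableC.
Qed.

End InvariantSets.

Theorem theorem0p3 (R : realType) (G : groupType) (X : ptopologicalType)
    (dist : X -> X -> R) (Rel : set (borel X * borel X))
    (mu : probability (borel X) R) (Q : G -> borel X -> borel X)
    (rn : G -> borel X -> R) (X0 : set (borel X))
    (alpha : borel X * borel X -> R)
    (G_countable : countable [set: G])
    (G_infinite : infinite_set [set: G])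
    (G_amenable : amenable R G)
    (X_polish : polish_ultrametric dist)
    (Rel_cber : countable_borel_equivalence Rel)
    (Q_nonsingular : nonsingular mu Q)
    (Q_conservative : conservative mu Q)
    (rn_version : forall g, is_rn_derivative mu (Q g) (rn g))
    (X0_conull : mu.-negligible (~` X0))
    (Rel_invariant : forall g,
      product_action Q Q g @` (Rel `&` X0 `*` X0) = Rel `&` X0 `*` X0)
    (Q_Rel_free : forall x g, X0 x -> Rel (Q g x, x) -> g = 1%g)
    (Q_inv_ergodic : inv_ergodic mu Q Rel)
    (Q_contracts : forall x y, (Rel `&` X0 `*` X0) (x, y) ->
      forall e : R, 0 < e -> exists2 F : set G, finite_set F &
        forall g, ~ F g -> dist (Q g x) (Q g y) < e)
    (alpha_borel : measurable_fun Rel alpha)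
    (alpha_ge1 : forall p, Rel p -> 1 <= alpha p)
    (alpha_bound : forall x y, (Rel `&` X0 `*` X0) (x, y) -> forall g,
      (alpha (x, y))^-1 < rn g x / rn g y /\ rn g x / rn g y < alpha (x, y)) :
  ergodic mu Q /\ (inv_trivial mu Rel -> weakly_mixing mu Q).

Proof.
split.
  exact: (ergodic_of_inv_ergodic G_countable G_infinite G_amenable X_polish Rel_cber
    Q_nonsingular Q_conservative rn_version X0_conull Q_contracts alpha_ge1 alpha_bound
    Q_inv_ergodic).
exact: (weakly_mixing_of_inv_trivial G_countable G_infinite G_amenable X_polish Rel_cber
  Q_nonsingular Q_conservative rn_version X0_conull Q_contracts alpha_ge1 alpha_bound).
Qed.
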